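(* Assume $F$ is globally Lipschitz and $a:\mathbb{R}^n\to[0,\infty)$ is continuous with $D:=\{a=0\}\neq\emptyset$, and fix $\rho>0$. Then $\lim_{\beta\to\infty}\inf_{\mathcal{U}_\rho}\mathcal{F}^\beta_\rho=\inf_{\mathcal{U}_\rho}\mathcal{F}_\rho$. Moreover, if $\mathcal{F}_\rho\not\equiv+\infty$ and for each $\beta>0$ $\hat u_\beta$ is a minimizer of $\mathcal{F}^\beta_\rho$ (minimizers exist), then for every non-decreasing sequence $\beta_m\to+\infty$ the sequence $(\hat u_{\beta_m})_{m\ge1}$ is pre-compact in the strong $L^2$ topology, and each of its strong limit points is a minimizer of $\mathcal{F}_\rho$.
   Context: $x_0\in\mathbb{R}^n$ fixed; $\mathcal{U}=L^2([0,1],\mathbb{R}^k)$; $x_u$ solves $\dot x_u=F(x_u)u$, $x_u(0)=x_0$. $\mathcal{U}_\rho=\{u\in\mathcal{U}:\|u\|_{L^2}\le\rho\}$. $\mathcal{F}^\beta_\rho$ is the restriction to $\mathcal{U}_\rho$ of $\mathcal{F}^\beta(u)=\frac12\|u\|_{L^2}^2+\beta a(x_u(1))$. $\mathcal{F}_\rho:\mathcal{U}_\rho\to[0,+\infty]$ is $\mathcal{F}_\rho(u)=\frac12\|u\|_{L^2}^2$ if $x_u(1)\in D$, and $+\infty$ otherwise. *)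

(* Defs.v *)
From HB Require Import structures.
From mathcomp Require Import all_boot all_order all_algebra.
From mathcomp Require Import all_classical all_reals all_analysis.
Set Implicit Arguments. Unset Strict Implicit. Unset Printing Implicit Defensive.
Import Order.TTheory GRing.Theory Num.Theory.
Import numFieldNormedType.Exports.
Local Open Scope classical_set_scope.
Local Open Scope ring_scope.

Section Defs.
Variable R : realType.
Local Notation mu := (@lebesgue_measure R).
Definition I01 : set R := `[0%R, 1%R].
Definition I0t (t : R) : set R := `[0%R, t].

Definition sqn (k : nat) (v : 'cV[R]_k) : R := \sum_(i < k) (v i 0) ^+ 2.

(* Representatives of elements of U = L^2([0,1], R^k). *)
Definition L2ctrl (k : nat) : set (R -> 'cV[R]_k) :=
  [set u : R -> 'cV[R]_k | (forall i : 'I_k, measurable_fun I01 (fun t : R => u t i 0)) /\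
           (\int[mu]_(t in I01) (sqn (u t))%:E < +oo)%E].

Definition L2sq (k : nat) (u : R -> 'cV[R]_k) : R :=
  fine (\int[mu]_(t in I01) (sqn (u t))%:E).

Definition L2distsq (k : nat) (u v : R -> 'cV[R]_k) : R :=
  L2sq (fun t => u t - v t).

Definition Uball (k : nat) (rho : R) : set (R -> 'cV[R]_k) :=
  [set u : R -> 'cV[R]_k | L2ctrl u /\ Num.sqrt (L2sq u) <= rho].

(* x is a (Caratheodory) solution on [0,1] of x' = F(x) u, x(0) = x0:
   x(t) = x0 + \int_0^t F(x(s)) u(s) ds componentwise, with integrable integrand. *)
Definition is_traj (n k : nat) (F : 'cV[R]_n -> 'M[R]_(n, k)) (x0 : 'cV[R]_n)
  (u : R -> 'cV[R]_k) (x : R -> 'cV[R]_n) : Prop :=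
  forall t : R, 0 <= t <= 1 -> forall i : 'I_n,
    mu.-integrable (I0t t) (fun s => ((F (x s) *m u s) i 0)%:E) /\
    x t i 0 = x0 i 0 + fine (\int[mu]_(s in I0t t) ((F (x s) *m u s) i 0)%:E).

(* x_u(1): the endpoint of the (unique, under the hypotheses) trajectory. *)
Definition endpt (n k : nat) (F : 'cV[R]_n -> 'M[R]_(n, k)) (x0 : 'cV[R]_n)
  (u : R -> 'cV[R]_k) : 'cV[R]_n :=
  xget 0 [set y | exists x, is_traj F x0 u x /\ x 1 = y].

Definition Fbeta (n k : nat) (F : 'cV[R]_n -> 'M[R]_(n, k)) (x0 : 'cV[R]_n)
  (a : 'cV[R]_n -> R) (beta : R) (u : R -> 'cV[R]_k) : R :=
  2^-1 * L2sq u + beta * a (endpt F x0 u).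

Definition Frho (n k : nat) (F : 'cV[R]_n -> 'M[R]_(n, k)) (x0 : 'cV[R]_n)
  (a : 'cV[R]_n -> R) (u : R -> 'cV[R]_k) : \bar R :=
  if a (endpt F x0 u) == 0 then (2^-1 * L2sq u)%:E else +oo%E.

End Defs.

(* Main.v *)
Require Import Defs.
From HB Require Import structures.
From mathcomp Require Import all_boot all_order all_algebra.
From mathcomp Require Import all_classical all_reals all_analysis.
From mathcomp Require Import measurable_realfun ring lra.
Set Implicit Arguments. Unset Strict Implicit. Unset Printing Implicit Defensive.
Import Order.TTheory GRing.Theory Num.Theory.
Import numFieldNormedType.Exports.
Local Open Scope classical_set_scope.
Local Open Scope ring_scope.

(** Everything rests on one compactness statement: a bounded sequence of controls [u_m]
has a subsequence along which the endpoints converge to the endpoint of some control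
[w] with [||w|| <= liminf ||u_m||], and the convergence is strong as soon as
[||u_m|| <= ||w||].  Instead of weak limits, [w] is the strong limit of elements [v_N]
of almost minimal norm in the midpoint hulls of the tails [(u_m)_(m >= N)]: the
parallelogram law makes [v_N] a Cauchy sequence, and also controls [||u_m - v_N||] when the
norms of the [u_m] do not exceed [||w||].  The trajectories of the [u_m] are uniformly bounded
and 1/2-Hoelder, hence converge uniformly along a subsequence to some [x]; the defect
[x0 + \int_0^t F(x) u - x(t)] is affine in [u] and tends to 0 along [u_m], hence along
[v_N], so [x] is the trajectory of [w].

Minimizers of the penalized functionals exist by the direct method.  Since the penalized
minimizers satisfy [beta_m a(x(1)) <= C], their limits are admissible, and comparing with [w]
itself gives [||u_m|| <= ||w||], which is exactly the condition for strong convergence. *)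

(** * Square-integrable functions *)

(** The endpoint depends nonlinearly on the control, so endpoints cannot be followed along midpoints
    of controls. The way out is that the equation is linear in the control once the path is frozen:
    all controls are tested against the one limit path, never against their own. Midpoints replace
    general convex combinations because the parallelogram law involves nothing else. As controls are
    only square-integrable in time, Cauchy-Schwarz bounds squares of integrals; Gronwall's
    inequality is therefore applied to squared distances, and constants such as [C + 1] stand in for
    square roots. Controls are functions rather than classes, so a strong limit is determined only
    up to [L2distsq] zero, and norm and endpoint must be shown not to see the difference. *)

Section SquareIntegrable.
Context d (T : measurableType d) (R : realType).
Variables (mu : {measure set T -> \bar R}) (I : set T).
Hypotheses (mI : measurable I) (finI : (mu I < +oo)%E).
Implicit Types (A : set T) (f g h : T -> R).

Definition ible A f := mu.-integrable A (EFin \o f).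

(** Measurability of [f] is a separate clause: the square forgets the sign of [f]. *)
Definition sqible f := measurable_fun I f /\ ible I (fun t => f t ^+ 2).

Lemma le_ible A f g : measurable A -> measurable_fun A f ->
  (forall x, A x -> `|f x| <= g x) -> ible A g -> ible A f.
Proof.
move=> mA mf fg; apply: le_integrable => //; first exact/measurable_EFinP.
by move=> x Ax /=; rewrite lee_fin (le_trans (fg x Ax))// ler_norm.
Qed.

Lemma ibleS A B f : measurable A -> measurable B -> B `<=` A -> ible A f -> ible B f.
Proof. by rewrite /ible => mA mB BA; apply: integrableS. Qed.

Lemma ibleD A f g : measurable A -> ible A f -> ible A g -> ible A (fun t => f t + g t).
Proof. by move=> mA fi gi; exact: (integrableD mA fi gi). Qed.

Lemma ibleB A f g : measurable A -> ible A f -> ible A g -> ible A (fun t => f t - g t).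
Proof. by move=> mA fi gi; exact: (integrableB mA fi gi). Qed.

Lemma ibleZ A (c : R) f : measurable A -> ible A f -> ible A (fun t => c * f t).
Proof. by move=> mA fi; exact: (integrableZl mA c fi). Qed.

Lemma ible_sum A (J : Type) (s : seq J) (h : J -> T -> R) : measurable A ->
  (forall j, ible A (h j)) -> ible A (fun t => \sum_(j <- s) h j t).
Proof.
move=> mA ih; rewrite /ible.
have -> : EFin \o (fun t => \sum_(j <- s) h j t) =
  (fun t => \sum_(j <- s) (h j t)%:E)%E by apply/funext => t /=; rewrite sumEFin.
by apply: integrable_sum => // j _; exact: ih.
Qed.

Lemma ible_measurable A f : ible A f -> measurable_fun A f.
Proof. by move=> /measurable_int /measurable_EFinP. Qed.

Lemma bounded_ible A f (M : R) : measurable A -> A `<=` I -> measurable_fun A f ->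
  (forall x, A x -> `|f x| <= M) -> ible A f.
Proof.
move=> mA AI mf fM; apply: measurable_bounded_integrable => //.
  by apply: le_lt_trans (le_measure _ _ _ AI) _; rewrite ?inE.
by exists M; split; [exact: num_real|move=> y My x Ax /=; exact: le_trans (fM x Ax) (ltW My)].
Qed.

Lemma ible_cst A (c : R) : measurable A -> A `<=` I -> ible A (fun=> c).
Proof. by move=> mA AI; apply: (@bounded_ible _ _ `|c|). Qed.

Lemma sqible_measurable f : sqible f -> measurable_fun I f.
Proof. by case. Qed.

Lemma sqible_cst (c : R) : sqible (fun=> c).
Proof. by split => //; exact: ible_cst. Qed.

Lemma bounded_sqible f (M : R) : measurable_fun I f ->
  (forall x, I x -> `|f x| <= M) -> sqible f.
Proof.
move=> mf fM; split => //; apply: (@bounded_ible _ _ (M ^+ 2)) => //.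
  exact: measurable_funX.
by move=> x Ix; rewrite normrX lerXn2r ?nnegrE ?fM// (le_trans _ (fM x Ix)).
Qed.

Lemma sqibleM f g : sqible f -> sqible g -> ible I (fun t => f t * g t).
Proof.
move=> [mf f2] [mg g2]; apply: (@le_ible _ _ (fun t => f t ^+ 2 + g t ^+ 2)) => //.
- exact: measurable_funM.
- move=> x _; rewrite normrM -(real_normK (num_real (f x))) -(real_normK (num_real (g x))).
  have := sqr_ge0 (`|f x| - `|g x|); have := sqr_ge0 (`|f x| + `|g x|); nra.
- exact: ibleD.
Qed.

Lemma sqibleD f g : sqible f -> sqible g -> sqible (fun t => f t + g t).
Proof.
move=> sf sg; split; first by apply: measurable_funD; [case: sf|case: sg].
have -> : (fun t => (f t + g t) ^+ 2) = (fun t => (f t ^+ 2 + 2 * (f t * g t)) + g t ^+ 2).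
  by apply/funext => t; ring.
apply: ibleD => //; last by case: sg.
by apply: ibleD => //; [case: sf|apply: ibleZ => //; exact: sqibleM].
Qed.

Lemma sqibleZ (c : R) f : sqible f -> sqible (fun t => c * f t).
Proof.
move=> [mf f2]; split; first exact: measurable_funM.
have -> : (fun t => (c * f t) ^+ 2) = (fun t => c ^+ 2 * f t ^+ 2).
  by apply/funext => t; ring.
exact: ibleZ.
Qed.

Lemma sqibleB f g : sqible f -> sqible g -> sqible (fun t => f t - g t).
Proof.
move=> sf sg; have -> : (fun t => f t - g t) = (fun t => f t + (-1) * g t).
  by apply/funext => t; rewrite mulN1r.
by apply: sqibleD => //; exact: sqibleZ.
Qed.

Lemma sqible_norm f : sqible f -> sqible (fun t => `|f t|).
Proof.
move=> [mf f2]; split; first exact: measurableT_comp.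
by under eq_fun do rewrite real_normK ?num_real//.
Qed.

Lemma sqible_sum (J : Type) (s : seq J) (h : J -> T -> R) :
  (forall j, sqible (h j)) -> sqible (fun t => \sum_(j <- s) h j t).
Proof.
move=> sh; elim: s => [|j s IH].
  by under eq_fun do rewrite big_nil; exact: sqible_cst.
by under eq_fun do rewrite big_cons; exact: sqibleD.
Qed.

(** The polynomial [\int (f - x g)^2] in [x] is nonnegative; it is evaluated at its minimizer
    [a / c]. *)
Lemma cauchy_schwarz A f g : measurable A -> A `<=` I -> sqible f -> sqible g ->
  (\int[mu]_(t in A) (f t * g t)) ^+ 2 <=
  \int[mu]_(t in A) (f t ^+ 2) * \int[mu]_(t in A) (g t ^+ 2).
Proof.
move=> mA AI sf sg.
have iff : ible A (fun t => f t ^+ 2) by case: sf => _; exact: ibleS.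
have igg : ible A (fun t => g t ^+ 2) by case: sg => _; exact: ibleS.
have ifg : ible A (fun t => f t * g t) by apply: ibleS (sqibleM sf sg).
set a := Rintegral _ _ _; set b := Rintegral _ _ _; set c := Rintegral _ _ _.
have H (x : R) : 0 <= b - 2 * x * a + x ^+ 2 * c.
  have -> : b - 2 * x * a + x ^+ 2 * c = \int[mu]_(t in A) ((f t - x * g t) ^+ 2).
    transitivity (\int[mu]_(t in A) ((f t ^+ 2 - (2 * x) * (f t * g t)) + x ^+ 2 * g t ^+ 2)).
      rewrite RintegralD//; [|by apply: ibleB => //; exact: ibleZ|exact: ibleZ].
      rewrite RintegralB//; last exact: ibleZ.
      by rewrite !RintegralZl.
    by apply: eq_Rintegral => t _; ring.
  by apply: Rintegral_ge0 => t _; exact: sqr_ge0.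
have c0 : 0 <= c by apply: Rintegral_ge0 => t _; exact: sqr_ge0.
have [c00|cn0] := eqVneq c 0.
  rewrite c00 mulr0; have [-> |an0] := eqVneq a 0; first by rewrite expr0n.
  (* With [c = 0] the polynomial is affine in [x]; this [x] gives it the value -1. *)
  have := H ((b + 1) / (2 * a)); rewrite c00 mulr0 addr0.
  have -> : 2 * ((b + 1) / (2 * a)) * a = b + 1 by field.
  lra.
have cp : 0 < c by rewrite lt_def cn0.
have := H (a / c).
have -> : b - 2 * (a / c) * a + (a / c) ^+ 2 * c = (b * c - a ^+ 2) / c by field.
by rewrite pmulr_lge0 ?invr_gt0// subr_ge0.
Qed.

End SquareIntegrable.

(** * Extraction of subsequences and geometric convergence *)

(** Each [P j] holds arbitrarily far out, so the index for [j.+1] can be chosen beyond the one for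
    [j]. *)
Lemma extraction (P : nat -> nat -> Prop) :
  (forall j m, exists2 p, (m <= p)%N & P j p) ->
  exists phi : nat -> nat, {homo phi : p q / (p < q)%N} /\ forall j, P j (phi j).
Proof.
move=> H.
have /choice[c cP] : forall jm : nat * nat, exists p, (jm.2 <= p)%N /\ P jm.1 p.
  by move=> [j m]; have [p] := H j m; exists p.
pose phi := fix phi j := if j is j'.+1 then c (j, (phi j').+1) else c (0%N, 0%N).
exists phi; split; last by case=> [|j]; [exact: (cP (0%N, 0%N)).2|exact: (cP (j.+1, (phi j).+1)).2].
apply: homo_ltn => [y x z|j]; first exact: ltn_trans.
by have [] := cP (j.+1, (phi j).+1).
Qed.

Lemma homo_geq_id (phi : nat -> nat) : {homo phi : p q / (p < q)%N} -> forall j, (j <= phi j)%N.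
Proof. by move=> h; elim=> // j IH; exact: leq_ltn_trans (h _ _ (ltnSn j)). Qed.

(** The telescoping series converges absolutely. The explicit rate is kept because it yields uniform
    convergence when [C] does not depend on a parameter. *)
Lemma geometric_cvg (R : realType) (g : nat -> R) (C : R) :
  (forall j, `|g j.+1 - g j| <= C * 2^-1 ^+ j) ->
  exists l, g @ \oo --> l /\ forall j, `|g j - l| <= 2 * C * 2^-1 ^+ j.
Proof.
move=> dC; have C0 : 0 <= C by have := dC 0%N; rewrite expr0 mulr1; apply: le_trans.
have cv : cvgn (series (fun j => g j.+1 - g j)).
  apply: normed_cvg; apply: (@series_le_cvg _ _ (geometric C 2^-1)) => [j|j|j|].
  - exact: normr_ge0.
  - by apply: mulr_ge0 => //; exact: exprn_ge0.
  - exact: dC.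
  - by apply: is_cvg_geometric_series; rewrite ger0_norm// invf_lt1// ltr1n.
have gc : cvgn g.
  have -> : g = (fun j => g 0%N + series (fun j => g j.+1 - g j) j).
    by apply/funext => j; rewrite /series /= telescope_sumr// addrC subrK.
  by apply: is_cvgD => //; exact: is_cvg_cst.
exists (limn g); split => // j.
(* The factor [1 - 2^-1 ^+ m] is the exact partial geometric sum, which makes the induction
   close. *)
have H m : `|g j - g (j + m)%N| <= 2 * C * 2^-1 ^+ j * (1 - 2^-1 ^+ m).
  elim: m => [|m IH]; first by rewrite addn0 subrr normr0 expr0 subrr mulr0.
  have := dC (j + m)%N; rewrite exprD -addnS => Hd.
  have := ler_distD (g (j + m)%N) (g j) (g (j + m.+1)%N).
  rewrite (distrC (g (j + m)%N)) exprS; move: Hd IH.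
  set p := _ ^+ j; set q := _ ^+ m; lra.
have cd : (fun m => `|g j - g m|) @ \oo --> `|g j - limn g|.
  by apply: cvg_norm; apply: cvgB => //; exact: cvg_cst.
rewrite -(cvg_lim _ cd)//; apply: limr_le; first by apply/cvg_ex; eexists; exact: cd.
exists j => // m /= jm; rewrite -(subnKC jm); apply: le_trans (H _) _.
have : 0 <= 2^-1 ^+ (m - j) :> R by exact: exprn_ge0.
have : 0 <= 2^-1 ^+ j :> R by exact: exprn_ge0.
set p := _ ^+ j; set q := _ ^+ (m - j) => p0 q0.
have : 0 <= C * p * q by rewrite !mulr_ge0.
lra.
Qed.

(** * Completeness of square-integrable functions *)

Section Completeness.
Context d (T : measurableType d) (R : realType).
Variables (mu : {measure set T -> \bar R}) (I : set T).
Hypothesis mI : measurable I.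
Local Notation sqible := (sqible mu I).
Local Notation ible := (ible mu).

Lemma EFin_Rintegral (A : set T) (f : T -> R) : measurable A -> ible A f ->
  (\int[mu]_(t in A) (f t))%:E = (\int[mu]_(t in A) (f t)%:E)%E.
Proof. by move=> mA fi; rewrite fineK//; exact: (integrable_fin_num mA fi). Qed.

(* Geometrically decaying increments in L^2 are square-summable with weight 4^j
   almost everywhere, hence dominated there by a geometric series. *)
Lemma sqible_ae_cvg (g : nat -> T -> R) : (forall j, sqible (g j)) ->
  (forall j, \int[mu]_(t in I) ((g j.+1 t - g j t) ^+ 2) <= 8^-1 ^+ j) ->
  exists2 N, [/\ measurable N, N `<=` I & mu N = 0%E] &
    forall t, (I `\` N) t -> cvgn (fun j => g j t).
Proof.
move=> sg Hg.
pose s j t : R := 4 ^+ j * (g j.+1 t - g j t) ^+ 2.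
pose S t := (\sum_(j <oo) (s j t)%:E)%E.
have si j : ible I (s j).
  by apply: ibleZ => //; case: (sqibleB mI (sg j.+1) (sg j)).
have s0 j t : (0 <= (s j t)%:E)%E.
  by rewrite lee_fin /s mulr_ge0 // ?sqr_ge0 // exprn_ge0.
have ms j : measurable_fun I (EFin \o s j) by exact: measurable_int (si j).
have mS : measurable_fun I S.
  by apply: ge0_emeasurable_sum => [*|*]; [exact: s0|exact: ms].
have S0 t : (0 <= S t)%E by apply: nneseries_ge0 => *; exact: s0.
have iS : (\int[mu]_(t in I) S t < +oo)%E.
  rewrite integral_nneseries//.
  (* The [j]-th weighted integral is at most [4 ^+ j * 8^-1 ^+ j = 2^-1 ^+ j], and these sum to
     2. *)
  apply: (@le_lt_trans _ _ (2:R)%:E); last exact: ltry.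
  apply: le_trans (epsilon_trick0 xpredT (ler0n R 2)).
  apply: lee_nneseries => [j _ _|j _].
    by apply: integral_ge0 => *; exact: s0.
  rewrite -EFin_Rintegral// lee_fin RintegralZl//; last first.
    by case: (sqibleB mI (sg j.+1) (sg j)).
  apply: (@le_trans _ _ (4 ^+ j * 8^-1 ^+ j)); first by rewrite ler_wpM2l ?exprn_ge0.
  rewrite -exprMn natrX exprS invfM mulrA divff ?mul1r -?exprVn//.
  by rewrite (_ : 4 / 8 = 2^-1) //; field.
have iSI : mu.-integrable I S.
  apply/integrableP; split => //; apply: le_lt_trans iS.
  by apply: ge0_le_integral => //; [exact: measurableT_comp|move=> t _; rewrite gee0_abs].
exists (I `&` S @^-1` [set +oo%E]).
  split; [exact: mS|exact: subIsetl|].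
  have [N [mN N0 sN]] := integrable_ae mI iSI.
  apply: (subset_measure0 _ mN _ N0); first exact: mS.
  by apply: subset_trans sN => t [It /= St] /=; rewrite St => /(_ It).
move=> t [It /not_andP[//|/= St]].
have Sfin : S t \is a fin_num by rewrite ge0_fin_numE// lt_neqAle leey andbT; apply/eqP.
pose C := fine (S t).
have C0 : 0 <= C by rewrite fine_ge0.
have sC j : s j t <= C.
  rewrite -lee_fin fineK//; apply: le_trans (nneseries_lim_ge j.+1 _); last first.
    by move=> *; exact: s0.
  by rewrite big_nat_recr//= leeDr// sume_ge0.
(* [C + 1] serves as a bound for the square root of [C], since [C <= (C + 1) ^+ 2]. *)
have dC j : `|g j.+1 t - g j t| <= (C + 1) * 2^-1 ^+ j.
  rewrite -(@ler_pXn2r _ 2)// ?nnegrE// ?mulr_ge0 ?exprn_ge0 ?addr_ge0//.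
  rewrite real_normK ?num_real//.
  have := sC j; rewrite /s exprMn -exprM mulnC exprM.
  rewrite (_ : (2^-1 ^+ 2 : R) = 4^-1); last by field.
  rewrite exprVn ler_pdivlMr ?exprn_gt0// mulrC => /le_trans; apply.
  by rewrite sqrrD1; nra.
by have [l [gl _]] := geometric_cvg dC; apply/cvg_ex; exists l.
Qed.

(** Fatou's lemma off a null set. The bound is asked only eventually, which is the form in which the
    Cauchy property supplies it. *)
Lemma sqible_fatou (h : nat -> T -> R) (f : T -> R) (N : set T) (e : R) :
  measurable N -> N `<=` I -> mu N = 0%E ->
  (forall j, sqible (h j)) -> measurable_fun I f ->
  (forall t, (I `\` N) t -> h j t @[j --> \oo] --> f t) ->
  (\forall j \near \oo, \int[mu]_(t in I) (h j t ^+ 2) <= e) ->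
  sqible f /\ \int[mu]_(t in I) (f t ^+ 2) <= e.
Proof.
move=> mN NI N0 sh mf hf he.
have mf2 : measurable_fun I (EFin \o (fun t => f t ^+ 2)).
  by apply/measurable_EFinP; exact: measurable_funX.
have mIN : measurable (I `\` N) by exact: measurableD.
have le : (\int[mu]_(t in I) (f t ^+ 2)%:E <= e%:E)%E.
  rewrite (ge0_negligible_integral mN)//; last by move=> *; rewrite lee_fin sqr_ge0.
  have -> : (\int[mu]_(t in I `\` N) (f t ^+ 2)%:E =
      \int[mu]_(t in I `\` N) limn_einf (fun j => (h j t ^+ 2)%:E))%E.
    apply: eq_integral => t /set_mem tIN; apply/esym.
    apply: (cvg_limn_einf_sup _).1; apply: cvg_EFin; first exact: nearW.
    exact: (cvgM (hf t tIN) (hf t tIN)).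
  apply: (le_trans (@fatou _ _ _ mu _ mIN _ _ _)) => [j|*|].
  - apply/measurable_EFinP/measurable_funX.
    by apply: measurable_funS (sqible_measurable (sh j)) => //; exact: subDsetl.
  - by rewrite lee_fin sqr_ge0.
  rewrite limn_einf_lim; apply: lime_le; first exact: is_cvg_einfs.
  apply: filterS he => j hj; apply: (@le_trans _ _ (\int[mu]_(x in I `\` N) (h j x ^+ 2)%:E)%E).
    by apply: ereal_inf_lbound; exists j => //=.
  rewrite -(ge0_negligible_integral mN)//; last 2 first.
  - exact/measurable_EFinP/measurable_funX/sqible_measurable.
  - by move=> *; rewrite lee_fin sqr_ge0.
  by rewrite -EFin_Rintegral ?lee_fin//; case: (sh j).
have fi : ible I (fun t => f t ^+ 2).
  apply/integrableP; split => //; apply: le_lt_trans (ltry e); apply: le_trans le.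
  apply: ge0_le_integral => //; first exact: measurableT_comp.
  by move=> t _ /=; rewrite lee_fin ger0_norm// sqr_ge0.
by split; [split|rewrite -lee_fin EFin_Rintegral].
Qed.

(** Riesz-Fischer: a fast subsequence converges almost everywhere to some [g], and Fatou applied to
    [f p - f (phi j)] with [p] fixed gives the distance of the whole sequence to [g]. *)
Lemma sqible_complete (f : nat -> T -> R) : (forall p, sqible (f p)) ->
  (forall e, 0 < e -> exists N, forall p q, (N <= p)%N -> (N <= q)%N ->
     \int[mu]_(t in I) ((f p t - f q t) ^+ 2) <= e) ->
  exists g, sqible g /\ (fun p => \int[mu]_(t in I) ((f p t - g t) ^+ 2)) @ \oo --> 0.
Proof.
move=> sf cf.
have [phi [phiH phiP]] : exists phi : nat -> nat, {homo phi : p q / (p < q)%N} /\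
    forall j p q, (phi j <= p)%N -> (phi j <= q)%N ->
      \int[mu]_(t in I) ((f p t - f q t) ^+ 2) <= 8^-1 ^+ j.
  apply: (@extraction (fun j p0 => forall p q, (p0 <= p)%N -> (p0 <= q)%N ->
    \int[mu]_(t in I) ((f p t - f q t) ^+ 2) <= 8^-1 ^+ j)) => j m; 
  have [|N NP] := cf (8^-1 ^+ j); first by rewrite exprn_gt0// invr_gt0.
  exists (maxn N m); first exact: leq_maxr.
  by move=> p q; rewrite !geq_max => /andP[? _] /andP[? _]; exact: NP.
have [||N [mN NI N0] gcvg] := @sqible_ae_cvg (fun j => f (phi j)).
- by move=> j; exact: sf.
- by move=> j; apply: phiP => //; apply: ltnW; apply: phiH.
pose g t := if t \in (I `\` N) then limn (fun j => f (phi j) t) else 0.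
have gl t : (I `\` N) t -> f (phi j) t @[j --> \oo] --> g t.
  by move=> tIN; rewrite /g mem_set//; exact: gcvg.
have mg : measurable_fun I g.
  (* Multiplying by the indicator of [I \ N] turns the almost everywhere limit into a limit at every
     point of [I]. *)
  apply: (@measurable_fun_cvg _ _ _ _ (fun j t => f (phi j) t * \1_(I `\` N) t)).
    move=> j; apply: measurable_funM; first exact: sqible_measurable.
    by apply: measurable_indic; exact: measurableD.
  move=> t It; rewrite /g indicE; case: ifPn => [/set_mem tIN|tN].
    by under eq_fun do rewrite mulr1; exact: gcvg.
  by under eq_fun do rewrite mulr0; exact: cvg_cst.
have key e : 0 < e -> exists M, forall p, (M <= p)%N -> sqible (fun t => f p t - g t) /\
    \int[mu]_(t in I) ((f p t - g t) ^+ 2) <= e.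
  move=> e0; have [M MP] := cf e e0; exists M => p Mp.
  apply: (@sqible_fatou (fun j t => f p t - f (phi j) t) _ N) => //.
  - by move=> j; exact: sqibleB.
  - by apply: measurable_funB => //; exact: sqible_measurable.
  - by move=> t tIN; apply: cvgB; [exact: cvg_cst|exact: gl].
  - by exists M => // j /= Mj; apply: MP => //; exact: leq_trans (homo_geq_id phiH j).
exists g; split.
  have [M /(_ M (leqnn M))[sfg _]] := key 1 ltr01.
  have -> : g = (fun t => f M t - (f M t - g t)) by apply/funext => t; ring.
  exact: sqibleB.
apply/cvgrPdist_le => e e0; have [M MP] := key e e0; exists M => // p /= Mp.
rewrite sub0r normrN ger0_norm; first by have [] := MP p Mp.
by apply: Rintegral_ge0 => t _; exact: sqr_ge0.
Qed.

End Completeness.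

(** * Controls and midpoint hulls *)

Lemma cvg_sum0 (R : realType) (J : Type) (s : seq J) (f : J -> nat -> R) :
  (forall j, f j @ \oo --> 0) -> (fun p => \sum_(j <- s) f j p) @ \oo --> 0.
Proof.
move=> f0; elim: s => [|j s IH].
  by under eq_fun do rewrite big_nil; exact: cvg_cst.
under eq_fun do rewrite big_cons.
have H := cvgD (f0 j) IH; rewrite addr0 in H; exact: H.
Qed.

Section Controls.
Variables (R : realType) (k : nat).
Local Notation mu := (@lebesgue_measure R).
Local Notation I := (@I01 R).
Local Notation ctrl := (R -> 'cV[R]_k).
Implicit Types (u v w : ctrl).

Lemma measurable_I01 : measurable (I : set (measurableTypeR R)).
Proof. exact: measurable_itv. Qed.

Lemma measure_I01 : mu I = 1%E.
Proof. by rewrite /I01 lebesgue_measure_itv/= lte_fin ltr01 oppr0 adde0. Qed.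

Lemma measure_I01_fin : (mu I < +oo)%E.
Proof. by rewrite measure_I01 ltry. Qed.

Let mI := measurable_I01.
Let finI := measure_I01_fin.

Lemma L2ctrlP u : L2ctrl u <-> forall i, sqible mu I (fun t => u t i 0).
Proof.
split=> [[mu_ fin] i|su].
  have mi j : measurable_fun (I : set (measurableTypeR R)) (fun t => u t j 0) by exact: mu_.
  split => //; apply/integrableP; split; first exact/measurable_EFinP/measurable_funX.
  apply: le_lt_trans fin; apply: ge0_le_integral => //.
  - by apply: measurableT_comp => //; exact/measurable_EFinP/measurable_funX.
  - by apply/measurable_EFinP; apply: measurable_sum => *; exact: measurable_funX.
  - move=> t _ /=; rewrite lee_fin ger0_norm ?sqr_ge0// /sqn (bigD1 i)//= lerDl.
    by apply: sumr_ge0 => j _; exact: sqr_ge0.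
split=> [i|]; first exact: (su i).1.
rewrite -EFin_Rintegral ?ltry//.
by apply: ible_sum => // i; exact: (su i).2.
Qed.

Lemma sqn_ge0 (x : 'cV[R]_k) : 0 <= sqn x.
Proof. by apply: sumr_ge0 => i _; exact: sqr_ge0. Qed.

Lemma L2sq_ge0 u : 0 <= L2sq u.
Proof. by apply: fine_ge0; apply: integral_ge0 => t _; rewrite lee_fin sqn_ge0. Qed.

Lemma L2sqE u : L2sq u = \int[mu]_(t in I) sqn (u t). Proof. by []. Qed.

Lemma L2ctrl_ible u : L2ctrl u -> ible mu I (fun t => sqn (u t)).
Proof. by move=> /L2ctrlP su; apply: ible_sum => // i; exact: (su i).2. Qed.

Lemma L2sq_sum u : L2ctrl u -> L2sq u = \sum_(i < k) \int[mu]_(t in I) (u t i 0) ^+ 2.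
Proof.
move=> /L2ctrlP su; rewrite L2sqE /sqn; apply: EFin_inj.
rewrite EFin_Rintegral//; last by apply: ible_sum => // i; exact: (su i).2.
under eq_integral do rewrite -sumEFin.
rewrite integral_sum//; last by move=> i; exact: (su i).2.
rewrite -sumEFin; apply: eq_bigr => i _; rewrite EFin_Rintegral//; exact: (su i).2.
Qed.

Definition midpoint u v : ctrl := fun t => 2^-1 *: (u t + v t).

Lemma L2ctrl_mid u v : L2ctrl u -> L2ctrl v -> L2ctrl (midpoint u v).
Proof.
move=> /L2ctrlP su /L2ctrlP sv; apply/L2ctrlP => i.
have -> : (fun t => midpoint u v t i 0) = (fun t => 2^-1 * (u t i 0 + v t i 0)).
  by apply/funext => t; rewrite !mxE.
by apply: sqibleZ => //; exact: sqibleD.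
Qed.

Lemma L2ctrlB u v : L2ctrl u -> L2ctrl v -> L2ctrl (fun t => u t - v t).
Proof.
move=> /L2ctrlP su /L2ctrlP sv; apply/L2ctrlP => i.
have -> : (fun t => (u t - v t) i 0) = (fun t => u t i 0 - v t i 0).
  by apply/funext => t; rewrite !mxE.
exact: sqibleB.
Qed.

Lemma L2ctrl0 : L2ctrl (fun=> 0 : 'cV[R]_k).
Proof.
apply/L2ctrlP => i; have -> : (fun t : R => (0 : 'cV[R]_k) i 0) = (fun=> 0).
  by apply/funext => t; rewrite mxE.
exact: sqible_cst.
Qed.

Lemma L2sq0 : L2sq (fun=> 0 : 'cV[R]_k) = 0.
Proof.
rewrite L2sqE (_ : (fun t : R => _) = fun=> 0); first by rewrite Rintegral_cst// mul0r.
by apply/funext => t; rewrite /sqn big1// => i _; rewrite mxE expr0n.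
Qed.

Lemma L2distsqC u v : L2distsq u v = L2distsq v u.
Proof.
apply: eq_Rintegral => t _; apply: eq_bigr => i _.
by rewrite !mxE -sqrrN opprB.
Qed.

(** Reduces an inequality between squared norms to an elementary one at each time. *)
Lemma L2sq_le3 (u0 u1 u2 : ctrl) (a b : R) : L2ctrl u0 -> L2ctrl u1 -> L2ctrl u2 ->
  (forall t, sqn (u0 t) <= a * sqn (u1 t) + b * sqn (u2 t)) ->
  L2sq u0 <= a * L2sq u1 + b * L2sq u2.
Proof.
move=> /L2ctrl_ible i0 /L2ctrl_ible i1 /L2ctrl_ible i2 H; rewrite !L2sqE.
rewrite -!RintegralZl// -RintegralD//; [|exact: ibleZ|exact: ibleZ].
by apply: le_Rintegral => //; apply: ibleD => //; exact: ibleZ.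
Qed.

Lemma L2distsq_triangle u v w : L2ctrl u -> L2ctrl v -> L2ctrl w ->
  L2distsq u w <= 2 * L2distsq u v + 2 * L2distsq v w.
Proof.
move=> cu cv cw; apply: L2sq_le3 => [|||t]; try exact: L2ctrlB.
rewrite /sqn !mulr_sumr -big_split/=; apply: ler_sum => i _; rewrite !mxE.
have := sqr_ge0 ((u t i 0 - v t i 0) - (v t i 0 - w t i 0)); nra.
Qed.

(** Young's inequality, the gap being the square [e^-1 * (e * y - (x - y)) ^+ 2]. A factor
    arbitrarily close to 1 in front of [L2sq v] is what comparing norms of nearby controls
    requires. *)
Lemma L2sq_perturb u v (e : R) : L2ctrl u -> L2ctrl v -> 0 < e ->
  L2sq u <= (1 + e) * L2sq v + (1 + e^-1) * L2distsq u v.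
Proof.
move=> cu cv e0; apply: L2sq_le3 => [|||t] //; first exact: L2ctrlB.
rewrite /sqn !mulr_sumr -big_split/=; apply: ler_sum => i _; rewrite !mxE.
set x := u t i 0; set y := v t i 0.
have -> : (1 + e) * y ^+ 2 + (1 + e^-1) * (x - y) ^+ 2 =
  x ^+ 2 + e^-1 * (e * y - (x - y)) ^+ 2 by field; rewrite gt_eqF.
by rewrite lerDl mulr_ge0 ?sqr_ge0// invr_ge0 ltW.
Qed.

Lemma parallelogram u v : L2ctrl u -> L2ctrl v ->
  L2distsq u v <= 2 * L2sq u + 2 * L2sq v - 4 * L2sq (midpoint u v).
Proof.
move=> cu cv; rewrite lerBrDr /L2distsq !L2sqE.
have iu := L2ctrl_ible cu; have iv := L2ctrl_ible cv.
have id := L2ctrl_ible (L2ctrlB cu cv); have im := L2ctrl_ible (L2ctrl_mid cu cv).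
rewrite -!RintegralZl// -!RintegralD//; try exact: ibleZ.
apply: le_Rintegral => //; try by apply: ibleD => //; exact: ibleZ.
move=> t _; rewrite /sqn !mulr_sumr -!big_split/=; apply: ler_sum => i _; rewrite !mxE.
by rewrite le_eqVlt; apply/orP; left; apply/eqP; field.
Qed.

Lemma L2_complete (u : nat -> ctrl) : (forall p, L2ctrl (u p)) ->
  (forall e, 0 < e -> exists N, forall p q, (N <= p)%N -> (N <= q)%N ->
     L2distsq (u p) (u q) <= e) ->
  exists v, L2ctrl v /\ (fun p => L2distsq (u p) v) @ \oo --> 0.
Proof.
move=> cu cau.
have /choice[g gP] : forall i : 'I_k, exists g : R -> R, sqible mu I g /\
    (fun p => \int[mu]_(t in I) ((u p t i 0 - g t) ^+ 2)) @ \oo --> 0.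
  move=> i; apply: (sqible_complete mI (f := fun p t => u p t i 0)) => [p|e e0].
    exact: (L2ctrlP _).1.
  have [N NP] := cau e e0; exists N => p q Np Nq; apply: le_trans (NP p q Np Nq).
  have cd := L2ctrlB (cu p) (cu q).
  rewrite /L2distsq L2sq_sum// (bigD1 i)//=.
  rewrite [leLHS](_ : _ = \int[mu]_(t in I) ((u p t - u q t) i 0) ^+ 2); last first.
    by apply: eq_Rintegral => t _; rewrite !mxE.
  by rewrite lerDl; apply: sumr_ge0 => j _; apply: Rintegral_ge0 => t _; exact: sqr_ge0.
pose v t : 'cV[R]_k := \col_i g i t.
have cv : L2ctrl v.
  apply/L2ctrlP => i; rewrite (_ : (fun t => v t i 0) = g i); first exact: (gP i).1.
  by apply/funext => t; rewrite mxE.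
exists v; split => //.
have -> : (fun p => L2distsq (u p) v) =
    (fun p => \sum_(i < k) \int[mu]_(t in I) ((u p t i 0 - g i t) ^+ 2)).
  apply/funext => p; rewrite /L2distsq L2sq_sum//; last exact: L2ctrlB.
  by apply: eq_bigr => i _; apply: eq_Rintegral => t _; rewrite !mxE.
by apply: cvg_sum0 => i; exact: (gP i).2.
Qed.

(** The dyadic part of the convex hull of the tail. In this inductive form, every property stable
    under midpoints passes from the tail to its hull. *)
Inductive midhull (u : nat -> ctrl) (N : nat) : ctrl -> Prop :=
| midhull_base m : (N <= m)%N -> midhull u N (u m)
| midhull_mid v w : midhull u N v -> midhull u N w -> midhull u N (midpoint v w).

Lemma midhull_leq (u : nat -> ctrl) N M v : (N <= M)%N -> midhull u M v -> midhull u N v.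
Proof.
move=> NM; elim=> [m Mm|v1 v2 _ h1 _ h2]; last exact: midhull_mid.
by apply: midhull_base; exact: leq_trans Mm.
Qed.

Lemma midhull_L2ctrl (u : nat -> ctrl) N v : (forall m, L2ctrl (u m)) ->
  midhull u N v -> L2ctrl v.
Proof. by move=> cu; elim=> // v1 v2 _ h1 _ h2; exact: L2ctrl_mid. Qed.

(* Elements of almost minimal norm in the midpoint hulls of the tails form a
   Cauchy sequence by the parallelogram law. Their limit plays the role of the weak limit of [u]. *)
Lemma midhull_limit (u : nat -> ctrl) (r : R) :
  (forall m, L2ctrl (u m)) -> (forall m, L2sq (u m) <= r) ->
  exists (v : nat -> ctrl) (w : ctrl),
   [/\ forall N, midhull u N (v N), L2ctrl w, (fun N => L2distsq (v N) w) @ \oo --> 0,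
     forall c, (forall N, exists2 m, (N <= m)%N & L2sq (u m) <= c) -> L2sq w <= c &
     (forall m, L2sq (u m) <= L2sq w) -> (fun m => L2distsq (u m) w) @ \oo --> 0].
Proof.
move=> cu ur.
pose S N := [set L2sq v | v in midhull u N].
pose C N := inf (S N).
have S0 N : S N !=set0 by exists (L2sq (u N)); exists (u N) => //; exact: midhull_base.
have Slb N : has_lbound (S N) by exists 0 => _ [v _ <-]; exact: L2sq_ge0.
have Cle N v : midhull u N v -> C N <= L2sq v.
  by move=> hv; apply: ge_inf; [exact: Slb|exists v].
have Cmono N M : (N <= M)%N -> C N <= C M.
  move=> NM; apply: lb_le_inf; [exact: S0|] => _ [v hv <-]; apply: Cle; exact: midhull_leq hv.
have Cr N : C N <= r by apply: le_trans (ur N); apply: Cle; exact: midhull_base.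
have /choice[v vP] : forall N, exists v, midhull u N v /\ L2sq v <= C N + N.+1%:R^-1.
  move=> N; have e0 : 0 < N.+1%:R^-1 :> R by rewrite invr_gt0.
  have iS : has_inf (S N) by split; [exact: S0|exact: Slb].
  by have [_ [v hv <-] vlt] := inf_adherent e0 iS; exists v; split => //; exact: ltW.
have cv N : L2ctrl (v N) by exact: (midhull_L2ctrl cu (vP N).1).
(* [C] is nondecreasing, as the hulls shrink, and bounded by [r]; [c] is its limit. *)
pose c := sup (range C).
have rC : has_sup (range C) by split; [exists (C 0%N); exists 0%N|exists r => _ [N _ <-]].
have Cc N : C N <= c by apply: sup_upper_bound => //; exists N.
have Ccv e : 0 < e -> exists N0, forall N, (N0 <= N)%N -> c - e <= C N /\ L2sq (v N) <= C N + e.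
  move=> e0; have [_ [N1 _ <-] N1P] := sup_adherent e0 rC.
  have [N2 _ N2P] := near_infty_natSinv_lt (PosNum e0).
  exists (maxn N1 N2) => N; rewrite geq_max => /andP[h1 h2]; split.
    by apply: le_trans (ltW N1P) _; exact: Cmono.
  by apply: le_trans (vP N).2 _; rewrite lerD2l; exact/ltW/(N2P N).
(* The midpoint lies in the same hull, so its squared norm is at least [C N]: two almost minimal
   elements are close. *)
have dist N v1 v2 : midhull u N v1 -> midhull u N v2 ->
    L2distsq v1 v2 <= 2 * L2sq v1 + 2 * L2sq v2 - 4 * C N.
  move=> h1 h2; apply: (le_trans (parallelogram (midhull_L2ctrl cu h1) (midhull_L2ctrl cu h2))).
  by have := Cle _ _ (midhull_mid h1 h2); lra.
have [w [cw vw]] : exists w, L2ctrl w /\ (fun p => L2distsq (v p) w) @ \oo --> 0.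
  apply: L2_complete => // e e0; have e8 : 0 < e / 8 by rewrite divr_gt0.
  have [N NP] := Ccv _ e8; exists N => p q Np Nq.
  have := @dist N (v p) (v q) (midhull_leq Np (vP p).1) (midhull_leq Nq (vP q).1).
  have [h1 h2] := NP _ Np; have [h3 h4] := NP _ Nq; have [h5 _] := NP _ (leqnn N).
  have := Cc p; have := Cc q; lra.
have lsc : L2sq w <= c.
  apply/ler_addgt0Pr => e e0.
  have r0 : 0 <= r by exact: le_trans (L2sq_ge0 _) (ur 0%N).
  have c0 : 0 <= c by apply: le_trans (Cc 0%N); apply: lb_le_inf; [exact: S0|move=> _ [z _ <-]; exact: L2sq_ge0].
  have c1 : 0 < c + 1 by lra.
  (* [d], [f] and [g] make each of [d * L2sq (v N)], the excess of [L2sq (v N)] over [c], and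
     [(1 + d^-1) * L2distsq (v N) w] at most [e / 4]. *)
  pose d := e / (4 * (c + 1)).
  have d0 : 0 < d by rewrite divr_gt0// mulr_gt0.
  pose f := Num.min 1 (e / 4).
  have f0 : 0 < f by rewrite lt_min ltr01 divr_gt0.
  pose g := e / (4 * (1 + d^-1)).
  have d1 : 0 < 1 + d^-1 by rewrite addr_gt0// invr_gt0.
  have g0 : 0 < g by rewrite divr_gt0// mulr_gt0.
  have [N1 N1P] := Ccv _ f0.
  have /cvgrPdist_le /(_ _ g0)[N2 _ N2P] := vw.
  pose N := maxn N1 N2.
  have [_ fN] := N1P N (leq_maxl _ _).
  have := N2P N (leq_maxr _ _); rewrite /= sub0r normrN ger0_norm ?L2sq_ge0// => gN.
  have := L2sq_perturb cw (cv N) d0; rewrite L2distsqC => /le_trans; apply.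
  have h1 : (1 + d^-1) * L2distsq (v N) w <= e / 4.
    apply: (@le_trans _ _ ((1 + d^-1) * g)); first by rewrite ler_wpM2l// ltW.
    rewrite /g; move: (lt0r_neq0 d1); set D := 1 + d^-1 => D0.
    by rewrite le_eqVlt; apply/orP; left; apply/eqP; field.
  have vc : L2sq (v N) <= c + f by have := Cc N; lra.
  have h2 : d * L2sq (v N) <= e / 4.
    apply: (@le_trans _ _ (d * (c + 1))).
      by rewrite ler_wpM2l ?(ltW d0)//; apply: le_trans vc _; rewrite lerD2l ge_min lexx.
    rewrite /d le_eqVlt; apply/orP; left; apply/eqP; field. by rewrite gt_eqF.
  have fe : f <= e / 4 by rewrite ge_min lexx orbT.
  lra.
exists v, w; split => //.
- by move=> N; have [] := vP N.
- move=> b Hb; apply: le_trans lsc _; apply: ge_sup; first by case: rC.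
  by move=> _ [N _ <-]; have [m Nm] := Hb N; apply: le_trans; apply: Cle; exact: midhull_base.
(* Now [u m] is itself almost minimal in its hull, as [L2sq (u m) <= L2sq w <= c], and is therefore
   close to [v m]. *)
- move=> uw; apply/cvgrPdist_le => e e0; have e16 : 0 < e / 16 by rewrite divr_gt0.
  have [N1 N1P] := Ccv _ e16; have /cvgrPdist_le /(_ _ e16)[N2 _ N2P] := vw.
  exists (maxn N1 N2) => // m /=; rewrite geq_max => /andP[m1 m2].
  rewrite sub0r normrN ger0_norm ?L2sq_ge0//.
  have [h1 h2] := N1P m m1.
  have := N2P m m2; rewrite /= sub0r normrN ger0_norm ?L2sq_ge0// => h3.
  have := L2distsq_triangle (cu m) (cv m) cw.
  have := dist m (u m) (v m) (midhull_base _ (leqnn m)) (vP m).1.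
  have := uw m; have := Cc m; lra.
Qed.

End Controls.

(** * Norms and Gronwall's inequality *)

Section Norms.
Variable R : realType.

Lemma mx_entry_le_norm m n (M : 'M[R]_(m, n)) i j : `|M i j| <= `|M|.
Proof.
by rewrite /Num.norm/= mx_normrE (le_bigmax _ (fun ij => `|M ij.1 ij.2|) (i, j)).
Qed.

(** Preferred to the maximum norm of matrices because integral estimates come entry by entry and a
    finite sum is visibly measurable. *)
Definition norm1 m (x : 'cV[R]_m) : R := \sum_(i < m) `|x i 0|.

Lemma norm1_ge0 m (x : 'cV[R]_m) : 0 <= norm1 x.
Proof. by apply: sumr_ge0. Qed.

Lemma entry_le_norm1 m (x : 'cV[R]_m) i : `|x i 0| <= norm1 x.
Proof. by rewrite /norm1 (bigD1 i)//= lerDl; apply: sumr_ge0. Qed.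

Lemma norm_le_norm1 m (x : 'cV[R]_m) : `|x| <= norm1 x.
Proof.
have [->|/mx_norm_neq0[[i j]]] := eqVneq `|x| 0; first exact: norm1_ge0.
by rewrite /Num.norm/= => ->/=; rewrite ord1; exact: entry_le_norm1.
Qed.

Lemma norm1_triangle m (x y z : 'cV[R]_m) : norm1 (x - z) <= norm1 (x - y) + norm1 (y - z).
Proof.
rewrite /norm1 -big_split/=; apply: ler_sum => i _; rewrite !mxE.
by rewrite (le_trans _ (ler_normD _ _))// addrA subrK.
Qed.

Lemma norm1C m (x y : 'cV[R]_m) : norm1 (x - y) = norm1 (y - x).
Proof. by apply: eq_bigr => i _; rewrite !mxE distrC. Qed.

Lemma norm1_le m (x : 'cV[R]_m) (e : R) : (forall i, `|x i 0| <= e) -> norm1 x <= m%:R * e.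
Proof.
move=> H; apply: (@le_trans _ _ (\sum_(i < m) e)); first by apply: ler_sum => i _.
by rewrite sumr_const card_ord mulr_natl.
Qed.

Lemma variance_ineq (q S Q : R) : 0 < q -> q != 0 ->
  0 <= Q - S * (S / q) * 2 + (S / q) ^+ 2 * q -> S ^+ 2 <= q * Q.
Proof.
move=> qp q0 H.
have -> : q * Q = S ^+ 2 + (Q - S * (S / q) * 2 + (S / q) ^+ 2 * q) * q by field.
by rewrite lerDl mulr_ge0// ltW.
Qed.

(** The sum of the squared deviations from the mean [S / m] is nonnegative. *)
Lemma sum_sqr_le (m : nat) (a : 'I_m -> R) :
  (\sum_i a i) ^+ 2 <= m%:R * \sum_i (a i) ^+ 2.
Proof.
case: m a => [|m] a; first by rewrite !big_ord0 mul0r expr0n.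
set S := \sum_i a i; set Q := \sum_i _.
have mp : 0 < m.+1%:R :> R by rewrite ltr0Sn.
have : 0 <= \sum_i (a i - S / m.+1%:R) ^+ 2 by apply: sumr_ge0 => i _; exact: sqr_ge0.
under eq_bigr do rewrite sqrrB.
rewrite big_split/= sumrB sumr_const card_ord -/Q sumrMnl -mulr_suml -/S.
have q0 : m.+1%:R != 0 :> R by rewrite pnatr_eq0.
rewrite -[_ ^+ 2 *+ m.+1]mulr_natr -[S * _ *+ 2]mulr_natr.
by move: (m.+1%:R) mp q0 => q; exact: variance_ineq.
Qed.

Lemma norm1_sqr_le m (x : 'cV[R]_m) (e : R) :
  (forall i, (x i 0) ^+ 2 <= e) -> norm1 x ^+ 2 <= m%:R ^+ 2 * e.
Proof.
move=> H; apply: (le_trans (sum_sqr_le _)); rewrite expr2 -mulrA ler_wpM2l//.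
apply: (@le_trans _ _ (\sum_(i < m) e)).
  by apply: ler_sum => i _; rewrite real_normK ?num_real.
by rewrite sumr_const card_ord mulr_natl.
Qed.

Lemma le_of_geometric (a b C : R) : (forall j : nat, a <= b + C * 2^-1 ^+ j) -> a <= b.
Proof.
move=> H; have : (fun j : nat => b + C * 2^-1 ^+ j) @ \oo --> b + 0.
  apply: cvgD; first exact: cvg_cst.
  by apply: (@cvg_geometric R C); rewrite ger0_norm// invf_lt1// ltr1n.
by rewrite addr0 => cv; rewrite -(cvg_lim _ cv)//; apply: limr_ge => //;
  [apply/cvg_ex; exists b|exact: nearW].
Qed.

End Norms.

Section Gronwall.
Variable R : realType.
Local Notation mu := (@lebesgue_measure R).
Local Notation I := (@I01 R).
Let mI := @measurable_I01 R.

Lemma measurable_I0t (t : R) : measurable (I0t t : set (measurableTypeR R)).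
Proof. exact: measurable_itv. Qed.

Lemma I0t_sub (t : R) : t <= 1 -> I0t t `<=` I.
Proof.
move=> t1 s; rewrite /I0t /I01 /= !in_itv/= => /andP[-> st] /=; exact: le_trans t1.
Qed.

Lemma Rintegral_expR_le (K t : R) : 0 < K -> 0 <= t <= 1 ->
  \int[mu]_(s in I0t t) expR (K * s) <= expR (K * t) / K.
Proof.
move=> K0 /andP[t0 t1].
have [->|tn0] := eqVneq t 0.
  by rewrite /I0t set_itv1 Rintegral_set1 divr_ge0// ?expR_ge0// ltW.
have tp : 0 < t by rewrite lt_def tn0.
have dE (s : R) : is_derive s 1 (fun s => expR (K * s) / K) (expR (K * s)).
  apply: is_derive_eq.
  rewrite /GRing.scale/= mulr1 mulr0 add0r.
  by field; rewrite gt_eqF.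
have cE : continuous (fun s => expR (K * s) / K).
  by move=> s; apply: differentiable_continuous; apply/derivable1_diffP; exact: (@ex_derive _ _ _ _ _ _ _ (dE s)).
have := @continuous_FTC2 R (fun s => expR (K * s)) (fun s => expR (K * s) / K) 0 t tp.
rewrite /Rintegral /I0t => -> /=.
- by rewrite lerBlDr lerDl divr_ge0// ?expR_ge0// ltW.
- apply: continuous_subspaceT => s; apply: continuous_comp.
    by apply: cvgM; [exact: cvg_cst|exact: cvg_id].
  exact: continuous_expR.
- split.
  + by move=> s _; exact: (@ex_derive _ _ _ _ _ _ _ (dE s)).
  + exact/cvg_at_right_filter/cE.
  + exact/cvg_at_left_filter/cE.
- by move=> s _; rewrite derive1E; exact: (@derive_val _ _ _ _ _ _ _ (dE s)).
Qed.

Lemma ible_expR (K t : R) : t <= 1 -> ible mu (I0t t) (fun s => expR (K * s)).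
Proof.
move=> t1; apply: continuous_compact_integrable; first exact: segment_compact.
apply: continuous_subspaceT => s; apply: continuous_comp.
  by apply: cvgM; [exact: cvg_cst|exact: cvg_id].
exact: continuous_expR.
Qed.

(** In the sup norm with weight [expR (K * s)], integration contracts by [1 / K]. This drives both
    Gronwall's inequality and the Picard iteration, on all of [0,1] at once. *)
Lemma gronwall_step (h : R -> R) (B K t : R) : 0 < K -> 0 <= B -> ible mu I h ->
  (forall s, I s -> h s <= B * expR (K * s)) -> 0 <= t <= 1 ->
  \int[mu]_(s in I0t t) h s <= B / K * expR (K * t).
Proof.
move=> K0 B0 ih hB /[dup] t01 /andP[t0 t1].
have mt := measurable_I0t t.
apply: (@le_trans _ _ (\int[mu]_(s in I0t t) (B * expR (K * s)))).
  apply: le_Rintegral => //.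
  - by apply: ibleS ih => //; exact: I0t_sub.
  - by apply: ibleZ => //; exact: ible_expR.
  - by move=> s st; apply: hB; exact: (I0t_sub t1).
rewrite RintegralZl//; last exact: ible_expR.
by rewrite -mulrA ler_wpM2l// mulrC; exact: Rintegral_expR_le.
Qed.

Lemma I01P (t : R) : I t <-> 0 <= t <= 1.
Proof. by rewrite /I01 /= in_itv. Qed.

(* A bound h(t) <= B e^(2Ct) improves itself to h(t) <= A + (B/2) e^(2Ct). *)
Lemma gronwall (h : R -> R) (A C M : R) : 0 <= A -> 0 < C -> ible mu I h ->
  (forall s, I s -> h s <= M) ->
  (forall t, I t -> h t <= A + C * \int[mu]_(s in I0t t) h s) ->
  forall t, I t -> h t <= 2 * A * expR (2 * C * t).
Proof.
move=> A0 C0 ih hM hC t It.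
wlog M0 : M hM / 0 <= M.
  by move=> W; apply: (W `|M|) => // s Is; apply: le_trans (hM s Is) (ler_norm _).
have e1 s : I s -> 1 <= expR (2 * C * s).
  move=> /I01P/andP[s0 _]; rewrite -expR0 ler_expR mulr_ge0// mulr_ge0// ltW//.
(* The a priori bound [M] only starts the iteration: its contribution halves at each step, while
   [2 * A] is the fixed point. *)
have H j : forall s, I s -> h s <= (2 * A + M * 2^-1 ^+ j) * expR (2 * C * s).
  elim: j => [|j IH] s Is.
    rewrite expr0 mulr1; apply: le_trans (hM s Is) _.
    have := e1 s Is; set E := expR _ => E1.
    have : M * 1 <= M * E by rewrite ler_wpM2l.
    have : 0 <= A * E by rewrite mulr_ge0// (le_trans _ E1).
    lra.
  have j0 : 0 <= 2 * A + M * 2^-1 ^+ j by rewrite addr_ge0 ?mulr_ge0// exprn_ge0.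
  have C2 : 0 < 2 * C by rewrite mulr_gt0.
  have := gronwall_step C2 j0 ih IH ((I01P s).1 Is).
  move=> /(ler_wpM2l (ltW C0)) /(lerD (lexx A)) /(le_trans (hC s Is)) => /le_trans; apply.
  have := e1 s Is; set E := expR _ => E1.
  have : A * 1 <= A * E by rewrite ler_wpM2l.
  rewrite mulrA exprS; set p := _ ^+ j.
  have -> : C * ((2 * A + M * p) / (2 * C)) = A + M * p / 2 by field; rewrite gt_eqF.
  nra.
apply: (@le_of_geometric _ _ _ (M * expR (2 * C * t))) => j.
by apply: le_trans (H j t It) _; rewrite mulrDl (mulrAC M).
Qed.

End Gronwall.

(** * Trajectories *)

Section Trajectories.
Variables (R : realType) (n k : nat) (x0 : 'cV[R]_n) (F : 'cV[R]_n -> 'M[R]_(n, k)) (L : R).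
Hypotheses (L0 : 0 <= L) (HF : forall x y, `|F x - F y| <= L * `|x - y|).
Local Notation mu := (@lebesgue_measure R).
Local Notation I := (@I01 R : set (measurableTypeR R)).
Local Notation meas f := (measurable_fun I f).
Implicit Types (u v w : R -> 'cV[R]_k) (x y : R -> 'cV[R]_n).

Let mI := @measurable_I01 R.
Let finI := @measure_I01_fin R.

Lemma lip_entry p q i j : `|F p i j - F q i j| <= L * norm1 (p - q).
Proof.
have -> : F p i j - F q i j = (F p - F q) i j by rewrite !mxE.
apply: le_trans (mx_entry_le_norm _ _ _) _; apply: le_trans (HF p q) _.
by rewrite ler_wpM2l// norm_le_norm1.
Qed.

Lemma lip_cvg (T : Type) (G : set_system T) (y : T -> 'cV[R]_n) (z : 'cV[R]_n) : Filter G ->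
  (forall i, y s i 0 @[s --> G] --> z i 0) -> forall i j, F (y s) i j @[s --> G] --> F z i j.
Proof.
move=> FG yz i j; apply/cvgrPdist_le => e e0.
(* The added ones keep the denominator positive when [L] or [n] is 0. *)
have d0 : 0 < e / ((L + 1) * (n%:R + 1)) by rewrite divr_gt0// mulr_gt0// ltr_wpDl.
have : \forall s \near G, forall l, `|z l 0 - y s l 0| <= e / ((L + 1) * (n%:R + 1)).
  apply: filter_forall => l; have /cvgrPdist_le /(_ _ d0) := yz l; exact.
apply: filterS => s ys; apply: le_trans (lip_entry _ _ _ _) _.
have : norm1 (z - y s) <= n%:R * (e / ((L + 1) * (n%:R + 1))).
  by apply: norm1_le => l; rewrite !mxE.
move=> /(ler_wpM2l L0) /le_trans; apply.
have n0 : 0 <= n%:R :> R by [].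
move: (n%:R) n0 => c c0.
rewrite !mulrA ler_pdivrMr; last by rewrite mulr_gt0// ltr_wpDl.
have : 0 <= (L + c + 1) * e by apply: mulr_ge0; [rewrite !addr_ge0|exact: ltW].
lra.
Qed.

(** Measurability of the entries of [F (x s)] is carried along with that of [x]: whatever makes [x]
    measurable, continuity or a pointwise limit, is passed on by the Lipschitz map [F]. *)
Definition meas_path x := (forall i, meas (fun s => x s i 0)) /\
  (forall i j, meas (fun s => F (x s) i j)).

Definition bounded_path x := exists M, forall s, I s -> norm1 (x s - x0) <= M.

Definition vfield u x i s := (F (x s) *m u s) i 0.

Definition picard u x t : 'cV[R]_n := \col_i (x0 i 0 + \int[mu]_(s in I0t t) vfield u x i s).

Lemma is_trajP u x : is_traj F x0 u x <->
  forall t, I t -> (forall i, ible mu (I0t t) (vfield u x i)) /\ x t = picard u x t.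
Proof.
split=> [H t /I01P t01|H t /I01P It i].
  split=> [i|]; first by have [] := H t t01 i.
  by apply/matrixP => i j; rewrite ord1 mxE; have [] := H t t01 i.
by have [h1 h2] := H t It; split; [exact: h1|rewrite h2 mxE].
Qed.

Lemma I01_1 : I 1. Proof. by apply/I01P; rewrite ler01 lexx. Qed.

(** Primitives are continuous on [0,1], and [F] preserves this. Serves Picard iterates and
    trajectories alike. *)
Lemma meas_path_primitive (f : 'I_n -> R -> R) x : (forall i, ible mu I (f i)) ->
  (forall t i, I t -> x t i 0 = x0 i 0 + \int[mu]_(s in I0t t) f i s) -> meas_path x.
Proof.
move=> fi xE.
have cx i : {within `[0, 1], continuous (fun t => x t i 0)}.
  have cf : {within `[0, 1], continuous (fun t => x0 i 0 + \int[mu]_(s in I0t t) f i s)}.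
    move=> t; apply: cvgD; first exact: cvg_cst.
    exact: (parameterized_integral_continuous ler01 (fi i)).
  by apply: subspace_eq_continuous cf => t /set_mem It; rewrite /from_subspace xE.
split=> [i|i j].
  by apply: subspace_continuous_measurable_fun => //; exact: cx.
apply: subspace_continuous_measurable_fun => //.
apply/subspace_continuousP => t It; apply: lip_cvg => l.
by have /subspace_continuousP/(_ t It) := cx l.
Qed.

Lemma meas_path_lim (y : nat -> R -> 'cV[R]_n) x : (forall m, meas_path (y m)) ->
  (forall s i, I s -> y m s i 0 @[m --> \oo] --> x s i 0) -> meas_path x.
Proof.
move=> my yx; split=> [i|i j].
  by apply: (measurable_fun_cvg (h := fun m s => y m s i 0)) => [m|s Is]; [exact: (my m).1|exact: yx].
apply: (measurable_fun_cvg (h := fun m s => F (y m s) i j)) => [m|s Is]; first exact: (my m).2.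
by apply: lip_cvg => l; exact: yx.
Qed.

Lemma meas_norm1B x y : meas_path x -> meas_path y -> meas (fun s => norm1 (x s - y s)).
Proof.
move=> mx my; apply: measurable_sum => i; apply: measurableT_comp => //.
have -> : (fun s => (x s - y s) i 0) = (fun s => x s i 0 - y s i 0).
  by apply/funext => s; rewrite !mxE.
by apply: measurable_funB; [exact: mx.1|exact: my.1].
Qed.

Lemma meas_path_cst : meas_path (fun=> x0).
Proof. by split. Qed.

(** One row of coefficients against the control. Taking for [p] a row of [F (x s)], or of a
    difference [F (x s) - F (y s)], gives growth and Lipschitz estimates from the same bound. *)
Definition pairing (p : R -> 'I_k -> R) u s : R := \sum_j p s j * u s j 0.

Lemma pairing_ible (p : R -> 'I_k -> R) (h : R -> R) u : L2ctrl u ->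
  (forall j, meas (fun s => p s j)) -> sqible mu I h ->
  (forall s j, I s -> `|p s j| <= h s) -> ible mu I (pairing p u).
Proof.
move=> /L2ctrlP su mp sh ph; apply: ible_sum => // j; apply: sqibleM => //.
split; first exact: mp.
apply: (le_ible _ _ _ sh.2) => //; first exact: measurable_funX.
move=> s Is; rewrite normrX lerXn2r ?nnegrE//; last exact: ph.
exact: le_trans (ph s j Is).
Qed.

(** Cauchy-Schwarz in time between [h] and the sum of the [|u s j 0|]; the factor [k] comes from
    squaring that sum. *)
Lemma pairing_bound (A : set R) (p : R -> 'I_k -> R) (h : R -> R) u :
  measurable (A : set (measurableTypeR R)) -> A `<=` I -> L2ctrl u ->
  (forall j, meas (fun s => p s j)) -> sqible mu I h ->
  (forall s j, I s -> `|p s j| <= h s) ->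
  (\int[mu]_(s in A) pairing p u s) ^+ 2 <= k%:R * L2sq u * \int[mu]_(s in A) (h s ^+ 2).
Proof.
move=> mA AI cu mp sh ph.
have ip := pairing_ible cu mp sh ph; have su := (L2ctrlP u).1 cu.
pose g s := \sum_(j < k) `|u s j 0|.
have sg : sqible mu I g by apply: sqible_sum => // j; exact: sqible_norm.
have ig : \int[mu]_(s in A) (g s ^+ 2) <= k%:R * L2sq u.
  rewrite L2sqE -RintegralZl//; last exact: L2ctrl_ible.
  apply: (@le_trans _ _ (\int[mu]_(s in I) (g s ^+ 2))).
    rewrite -lee_fin !EFin_Rintegral//; last 2 first.
      exact: sg.2.
      by apply: ibleS sg.2.
    apply: ge0_subset_integral => //; first by apply/measurable_EFinP; exact: ible_measurable sg.2.
    by move=> s _; rewrite lee_fin sqr_ge0.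
  apply: le_Rintegral => //; first exact: sg.2.
    by apply: ibleZ => //; exact: L2ctrl_ible.
  move=> s _; rewrite /g; apply: le_trans (sum_sqr_le _) _.
  by rewrite ler_wpM2l//; apply: ler_sum => j _; rewrite real_normK ?num_real.
have lehg : `|\int[mu]_(s in A) pairing p u s| <= \int[mu]_(s in A) (h s * g s).
  have ipA : ible mu A (pairing p u) by apply: ibleS ip.
  apply: le_trans (le_normr_Rintegral mA ipA) _; apply: le_Rintegral => //.
  - exact: (integrable_abse ipA).
  - by apply: ibleS (sqibleM mI sh sg).
  - move=> s As; rewrite /pairing /g mulr_sumr; apply: le_trans (ler_norm_sum _ _ _) _.
    by apply: ler_sum => j _; rewrite normrM ler_wpM2r// ph//; exact: AI.
rewrite -real_normK ?num_real//.
apply: (@le_trans _ _ ((\int[mu]_(s in A) (h s * g s)) ^+ 2)).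
  by rewrite lerXn2r// ?nnegrE// (le_trans _ lehg).
apply: le_trans (cauchy_schwarz mI mA AI sh sg) _.
by rewrite mulrC ler_wpM2r//; apply: Rintegral_ge0 => s _; exact: sqr_ge0.
Qed.
End Trajectories.

(** * A priori bounds, uniqueness and existence of trajectories *)

Section Flow.
Variables (R : realType) (n k : nat) (x0 : 'cV[R]_n) (F : 'cV[R]_n -> 'M[R]_(n, k)) (L : R).
Hypotheses (L0 : 0 <= L) (HF : forall x y, `|F x - F y| <= L * `|x - y|).
Local Notation mu := (@lebesgue_measure R).
Local Notation I := (@I01 R : set (measurableTypeR R)).
Implicit Types (u v w : R -> 'cV[R]_k) (x y : R -> 'cV[R]_n).
Local Notation vfield := (vfield F).
Local Notation picard := (picard x0 F).
Local Notation meas_path := (meas_path F).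
Local Notation bounded_path := (bounded_path x0).
Local Notation is_traj := (is_traj F x0).

Let mI := @measurable_I01 R.
Let finI := @measure_I01_fin R.
Let I0tS (t : R) (It : I t) : I0t t `<=` I.
Proof. by move/I01P : It => /andP[_]; exact: I0t_sub. Qed.

Lemma vfieldE u x i : vfield u x i = pairing (fun s j => F (x s) i j) u.
Proof. by apply/funext => s; rewrite /vfield /pairing mxE. Qed.

Lemma F_entry_bound (M : R) p i j : norm1 (p - x0) <= M -> `|F p i j| <= `|F x0| + L * M.
Proof.
move=> pM; have -> : F p i j = F x0 i j + (F p i j - F x0 i j) by ring.
apply: le_trans (ler_normD _ _) _; apply: lerD; first exact: mx_entry_le_norm.
by apply: le_trans (lip_entry L0 HF _ _ _ _) _; rewrite ler_wpM2l.
Qed.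

Lemma measure_itvoc (s t : R) : s <= t -> fine (mu (`]s, t] : set R)) = t - s.
Proof.
rewrite lebesgue_measure_itv/= lte_fin; case: ltgtP => //= -> _.
by rewrite subrr.
Qed.

Lemma measure_I0t (t : R) : 0 <= t -> fine (mu (I0t t)) = t.
Proof.
rewrite /I0t lebesgue_measure_itv/= lte_fin; case: ltgtP => //= _ _.
by rewrite oppr0 addr0.
Qed.

Lemma Rintegral_I0t_cst_le (c t : R) : 0 <= c -> I t -> \int[mu]_(s in I0t t) c <= c.
Proof.
move=> c0 /I01P/andP[t0 t1]; rewrite Rintegral_cst; last exact: measurable_I0t.
by rewrite (measure_I0t t0) -[leRHS]mulr1 ler_wpM2l.
Qed.

Lemma vfield_ible u x : meas_path x -> bounded_path x -> L2ctrl u ->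
  forall i, ible mu I (vfield u x i).
Proof.
move=> mx [M xM] cu i; rewrite vfieldE.
apply: (pairing_ible (h := fun=> `|F x0| + L * M)) => //.
- by move=> j; exact: mx.2.
- exact: sqible_cst.
- by move=> s j Is; apply: F_entry_bound; exact: xM.
Qed.

(** The majorant [h] is left free: a constant for paths known to be bounded, the linear growth bound
    itself when boundedness is still to be quantified. *)
Lemma vfield_bound (A : set R) (h : R -> R) u x i :
  measurable (A : set (measurableTypeR R)) -> A `<=` I -> L2ctrl u -> meas_path x ->
  sqible mu I h -> (forall s, I s -> `|F x0| + L * norm1 (x s - x0) <= h s) ->
  (\int[mu]_(s in A) vfield u x i s) ^+ 2 <= k%:R * L2sq u * \int[mu]_(s in A) (h s ^+ 2).
Proof.
move=> mA AI cu mx sh xh; rewrite vfieldE; apply: pairing_bound => //.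
- by move=> j; exact: mx.2.
- by move=> s j Is; apply: le_trans (xh s Is); exact: F_entry_bound.
Qed.

Lemma bounded_path_F x : bounded_path x -> exists2 B, 0 <= B &
  forall s, I s -> `|F x0| + L * norm1 (x s - x0) <= B.
Proof.
move=> [M xM]; exists (`|F x0| + L * `|M|); first by rewrite addr_ge0// mulr_ge0.
by move=> s Is; rewrite lerD2l ler_wpM2l// (le_trans (xM s Is))// ler_norm.
Qed.

Lemma bounded_path_cst : bounded_path (fun=> x0).
Proof. by exists 0 => s _; rewrite subrr /norm1 big1// => i _; rewrite mxE normr0. Qed.

Lemma le1_sqr (a : R) : a <= 1 + a ^+ 2.
Proof. by have := sqr_ge0 (a - 1); have := sqr_ge0 (a + 1); nra. Qed.

Lemma picard_meas u x : meas_path x -> bounded_path x -> L2ctrl u -> meas_path (picard u x).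
Proof.
move=> mx bx cu.
apply: (meas_path_primitive (x0 := x0) L0 HF (vfield_ible mx bx cu)).
by move=> t i It; rewrite mxE.
Qed.

Lemma picard_bounded u x : meas_path x -> bounded_path x -> L2ctrl u -> bounded_path (picard u x).
Proof.
move=> mx /bounded_path_F[B B0 xB] cu.
exists (1 + n%:R ^+ 2 * (k%:R * L2sq u * B ^+ 2)) => s Is.
apply: le_trans (le1_sqr _) _; rewrite lerD2l; apply: norm1_sqr_le => i.
rewrite !mxE addrAC subrr add0r.
apply: le_trans (vfield_bound i (measurable_I0t s) (I0tS Is) cu mx (sqible_cst mI finI B) xB) _.
by rewrite ler_wpM2l ?mulr_ge0 ?L2sq_ge0//; exact: Rintegral_I0t_cst_le (sqr_ge0 _) Is.
Qed.

Lemma norm1B_sqible x y : meas_path x -> bounded_path x -> meas_path y -> bounded_path y ->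
  sqible mu I (fun s => norm1 (x s - y s)).
Proof.
move=> mx [M xM] my [N yN]; apply: (@bounded_sqible _ _ _ _ _ mI finI _ (M + N)).
  exact: meas_norm1B mx my.
move=> s Is; rewrite ger0_norm ?norm1_ge0// (le_trans (norm1_triangle _ x0 _))//.
by rewrite lerD ?xM// norm1C yN.
Qed.

(** [n%:R ^+ 2] comes from passing from entries to [norm1], [k%:R * L2sq u] from Cauchy-Schwarz,
    [L ^+ 2] from the Lipschitz bound. *)
Definition lip_const u : R := n%:R ^+ 2 * (k%:R * L2sq u * L ^+ 2).

Lemma lip_const_ge0 u : 0 <= lip_const u.
Proof. by rewrite !mulr_ge0 ?exprn_ge0 ?L2sq_ge0. Qed.

Lemma picard_lip u x y t : meas_path x -> bounded_path x -> meas_path y -> bounded_path y ->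
  L2ctrl u -> I t -> norm1 (picard u x t - picard u y t) ^+ 2 <=
    lip_const u * \int[mu]_(s in I0t t) (norm1 (x s - y s) ^+ 2).
Proof.
move=> mx bx my by_ cu It; have mt := measurable_I0t t; have sI := I0tS It.
have sN := norm1B_sqible mx bx my by_.
rewrite /lip_const -mulrA; apply: norm1_sqr_le => i; rewrite !mxE.
rewrite opprD addrACA subrr add0r -RintegralB//; last 2 first.
- by apply: ibleS (vfield_ible mx bx cu i).
- by apply: ibleS (vfield_ible my by_ cu i).
rewrite [X in Rintegral _ _ X](_ : _ = pairing (fun s j => F (x s) i j - F (y s) i j) u); last first.
  apply/funext => s; rewrite !vfieldE /pairing -sumrB.
  by apply: eq_bigr => j _; rewrite mulrBl.
rewrite -mulrA -RintegralZl//; last by apply: ibleS sN.2.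
under [X in _ <= _ * X]eq_Rintegral do rewrite -exprMn.
apply: pairing_bound => //.
- by move=> j; apply: measurable_funB; [exact: mx.2|exact: my.2].
- exact: sqibleZ.
- by move=> s j Is; exact: lip_entry.
Qed.

Lemma traj_meas u x : is_traj u x -> meas_path x.
Proof.
move=> /is_trajP H; apply: (meas_path_primitive (x0 := x0) (f := vfield u x) L0 HF).
  by move=> i; have [+ _] := H 1 (@I01_1 R); exact.
by move=> t i It; rewrite (H t It).2 mxE.
Qed.

(** The displacement is at most the total mass of the velocity. Nothing uniform in [u] results, but
    Gronwall's inequality presupposes some bound. *)
Lemma traj_bounded u x : is_traj u x -> bounded_path x.
Proof.
move=> /is_trajP H; have iv i : ible mu I (vfield u x i) by have [+ _] := H 1 (@I01_1 R); exact.
exists (\sum_i \int[mu]_(s in I) `|vfield u x i s|) => t It; apply: ler_sum => i _.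
rewrite (H t It).2 !mxE addrAC subrr add0r.
have it : ible mu (I0t t) (vfield u x i) by have [+ _] := H t It; exact.
apply: le_trans (le_normr_Rintegral (measurable_I0t t) it) _.
rewrite -lee_fin !EFin_Rintegral//; last 3 first.
- exact: integrable_norm (iv i).
- exact: measurable_I0t.
- exact: integrable_norm it.
apply: ge0_subset_integral => //; [exact: measurable_I0t|..|exact: I0tS].
  exact: measurable_int (integrable_norm (iv i)).
Qed.

Lemma traj_eq u x t : is_traj u x -> I t -> x t = picard u x t.
Proof. by move=> /is_trajP H It; exact: (H t It).2. Qed.

Lemma traj_unique u x y t : L2ctrl u -> is_traj u x -> is_traj u y -> I t -> x t = y t.
Proof.
move=> cu tx ty It.
have mx := traj_meas tx; have my := traj_meas ty.
have bx := traj_bounded tx; have by_ := traj_bounded ty.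
have sN := norm1B_sqible mx bx my by_.
have [M hM] : exists M, forall s, I s -> norm1 (x s - y s) ^+ 2 <= M.
  have [Mx xM] := bx; have [My yM] := by_; exists ((Mx + My) ^+ 2) => s Is.
  have h : norm1 (x s - y s) <= Mx + My.
    apply: le_trans (norm1_triangle _ x0 _) _; rewrite lerD ?xM//.
    by rewrite norm1C yM.
  by rewrite lerXn2r ?nnegrE ?norm1_ge0// (le_trans _ h)// norm1_ge0.
(* The added 1 keeps the Gronwall constant positive even if [lip_const u] vanishes. *)
have C0 : 0 < lip_const u + 1 by rewrite ltr_wpDl// lip_const_ge0.
have := @gronwall R _ 0 (lip_const u + 1) M (lexx 0) C0 sN.2 hM _ t It.
rewrite mulr0 mul0r => H.
have N0 : norm1 (x t - y t) = 0.
  apply/eqP; rewrite -sqrf_eq0 eq_le sqr_ge0 andbT; apply: H => s Is.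
  rewrite add0r {1}(traj_eq tx Is) {1}(traj_eq ty Is).
  apply: le_trans (picard_lip mx bx my by_ cu Is) _.
  rewrite ler_wpM2r// ?lerDl//.
  by apply: Rintegral_ge0 => z _; exact: sqr_ge0.
apply/eqP; rewrite -subr_eq0 -normr_le0; apply: le_trans (norm_le_norm1 _) _.
by rewrite N0.
Qed.

Lemma endptP u x : L2ctrl u -> is_traj u x -> endpt F x0 u = x 1.
Proof.
move=> cu tx; rewrite /endpt; case: xgetP => [_ -> [y [ty <-]]|/(_ (x 1))[]].
  exact: traj_unique ty tx (@I01_1 R).
by exists x.
Qed.

Lemma traj_bound (r : R) : exists M, forall u x, L2ctrl u -> L2sq u <= r -> is_traj u x ->
  forall t, I t -> norm1 (x t - x0) <= M.
Proof.
(* [A] and [C] come from [(p + q) ^+ 2 <= 2 * p ^+ 2 + 2 * q ^+ 2] applied to the growth bound; the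
   sign of [r] is not assumed, hence [|r|]. *)
pose A : R := 2 * (n%:R ^+ 2 * (k%:R * `|r| * `|F x0| ^+ 2)).
pose C : R := 2 * (n%:R ^+ 2 * (k%:R * `|r| * L ^+ 2)) + 1.
have A0 : 0 <= A by rewrite !mulr_ge0.
have C0 : 0 < C by rewrite ltr_wpDl// !mulr_ge0 ?exprn_ge0.
exists (1 + 2 * A * expR (2 * C)) => u x cu ur tx t It.
have mx := traj_meas tx; have bx := traj_bounded tx.
have sN := norm1B_sqible mx bx (meas_path_cst x0 F) bounded_path_cst.
have [M xM] := bx.
have hM s : I s -> norm1 (x s - x0) ^+ 2 <= M ^+ 2.
  by move=> Is; rewrite lerXn2r ?nnegrE ?norm1_ge0 ?xM// (le_trans _ (xM s Is))// norm1_ge0.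
apply: le_trans (le1_sqr _) _; rewrite lerD2l.
apply: (@le_trans _ _ (2 * A * expR (2 * C * t))); last first.
  rewrite ler_wpM2l ?mulr_ge0// ler_expR -[leRHS]mulr1 ler_wpM2l ?mulr_ge0 ?(ltW C0)//.
  by move/I01P : It => /andP[].
apply: (gronwall A0 C0 sN.2 hM) It => {}t It.
have mt := measurable_I0t t; have sI := I0tS It.
have sN2 : ible mu (I0t t) (fun s => norm1 (x s - x0) ^+ 2) by apply: ibleS sN.2.
have sh : sqible mu I (fun s => `|F x0| + L * norm1 (x s - x0)).
  by apply: sqibleD => //; [exact: sqible_cst|exact: sqibleZ].
have le1 : \int[mu]_(s in I0t t) ((`|F x0| + L * norm1 (x s - x0)) ^+ 2) <=
    2 * `|F x0| ^+ 2 + 2 * L ^+ 2 * \int[mu]_(s in I0t t) (norm1 (x s - x0) ^+ 2).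
  apply: (@le_trans _ _ (\int[mu]_(s in I0t t)
      (2 * `|F x0| ^+ 2 + 2 * L ^+ 2 * norm1 (x s - x0) ^+ 2))).
    apply: le_Rintegral => //.
    - by apply: ibleS sh.2.
    - by apply: ibleD => //; [exact: (ible_cst mI finI)|exact: ibleZ].
    - by move=> s _; have := sqr_ge0 (`|F x0| - L * norm1 (x s - x0)); nra.
  rewrite RintegralD//; [|exact: (ible_cst mI finI)|exact: ibleZ].
  rewrite RintegralZl// lerD2r.
  by apply: Rintegral_I0t_cst_le => //; rewrite mulr_ge0.
have -> : A + C * \int[mu]_(s in I0t t) (norm1 (x s - x0) ^+ 2) =
    n%:R ^+ 2 * (k%:R * `|r| * (2 * `|F x0| ^+ 2 +
      2 * L ^+ 2 * \int[mu]_(s in I0t t) (norm1 (x s - x0) ^+ 2))) +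
    \int[mu]_(s in I0t t) (norm1 (x s - x0) ^+ 2) by rewrite /A /C; ring.
apply: ler_wpDr; first by apply: Rintegral_ge0 => s _; exact: sqr_ge0.
rewrite (traj_eq tx It); apply: norm1_sqr_le => i; rewrite !mxE addrAC subrr add0r.
apply: le_trans (vfield_bound i mt sI cu mx sh (fun s _ => lexx _)) _.
apply: ler_pM => //.
- by rewrite mulr_ge0 ?L2sq_ge0.
- by apply: Rintegral_ge0 => s _; exact: sqr_ge0.
- by rewrite ler_wpM2l// (le_trans ur)// ler_norm.
Qed.

(** With the velocity coefficients bounded uniformly, Cauchy-Schwarz on []s, t]] yields the length
    [t - s] as a factor. *)
Lemma traj_hoelder (r : R) : exists H, forall u x, L2ctrl u -> L2sq u <= r -> is_traj u x ->
  forall s t, 0 <= s -> s <= t -> t <= 1 -> norm1 (x t - x s) ^+ 2 <= H * (t - s).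
Proof.
have [M MP] := traj_bound r.
exists (n%:R ^+ 2 * (k%:R * `|r| * (`|F x0| + L * M) ^+ 2)) => u x cu ur tx s t s0 st t1.
have mx := traj_meas tx; have bx := traj_bounded tx.
have It : I t by apply/I01P; rewrite (le_trans s0 st).
have Is : I s by apply/I01P; rewrite s0 (le_trans st t1).
rewrite (traj_eq tx It) (traj_eq tx Is) -mulrA; apply: norm1_sqr_le => i.
have ist : ible mu (I0t t) (vfield u x i).
  by apply: ibleS (vfield_ible mx bx cu i) => //; [exact: measurable_I0t|exact: I0tS].
rewrite !mxE opprD addrACA subrr add0r Rintegral_itvB//.
have mst : measurable (`]s, t] : set (measurableTypeR R)) by exact: measurable_itv.
have sst : `]s, t] `<=` I.
  move=> z; rewrite /I01/= !in_itv/= => /andP[sz zt].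
  by rewrite (le_trans s0 (ltW sz)) (le_trans zt t1).
apply: le_trans (vfield_bound i mst sst cu mx (sqible_cst mI finI (`|F x0| + L * M)) _) _.
  by move=> z Iz; rewrite lerD2l ler_wpM2l//; exact: MP cu ur tx z Iz.
rewrite Rintegral_cst// (measure_itvoc st) -[leRHS]mulrA; apply: ler_wpM2r.
  by rewrite mulr_ge0 ?sqr_ge0// subr_ge0.
by rewrite ler_wpM2l// (le_trans ur)// ler_norm.
Qed.

(** Picard iteration from the constant path. With weight [expR (4 * C * t)] the squared increments
    shrink by 4, hence the increments by 2. *)
Lemma traj_exists u : L2ctrl u -> exists x, is_traj u x.
Proof.
move=> cu.
pose X := fix X j : R -> 'cV[R]_n := if j is j'.+1 then picard u (X j') else (fun=> x0).
have good j : meas_path (X j) /\ bounded_path (X j).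
  elim: j => [|j [mX bX]]; first by split; [exact: meas_path_cst|exact: bounded_path_cst].
  by split; [exact: picard_meas|exact: picard_bounded].
pose C := lip_const u + 1.
have C0 : 0 < C by rewrite ltr_wpDl// lip_const_ge0.
have [M0 hM0] := (good 1%N).2; pose M := `|M0|.
have M_ge0 : 0 <= M by exact: normr_ge0.
have K0 : 0 < 4 * C by rewrite mulr_gt0.
have step j : forall t, I t ->
    norm1 (X j.+1 t - X j t) ^+ 2 <= M ^+ 2 * 4^-1 ^+ j * expR (4 * C * t).
  elim: j => [|j IH] t It.
    rewrite expr0 mulr1; apply: (@le_trans _ _ (M ^+ 2)).
      apply: lerXn2r; rewrite ?nnegrE ?norm1_ge0 ?M_ge0//.
      exact: (le_trans (hM0 t It) (ler_norm _)).
    rewrite -[leLHS]mulr1 ler_wpM2l ?sqr_ge0// -[leLHS]expR0 ler_expR.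
    by apply: mulr_ge0; [exact: ltW|move/I01P : It => /andP[]].
  have [mX bX] := good j; have [mX1 bX1] := good j.+1.
  have sN := norm1B_sqible mX1 bX1 mX bX.
  apply: le_trans (picard_lip mX1 bX1 mX bX cu It) _.
  have j0 : 0 <= M ^+ 2 * 4^-1 ^+ j by rewrite mulr_ge0 ?sqr_ge0// exprn_ge0.
  have := gronwall_step K0 j0 sN.2 IH ((I01P t).1 It).
  have i0 : 0 <= \int[mu]_(s in I0t t) norm1 (X j.+1 s - X j s) ^+ 2.
    by apply: Rintegral_ge0 => z _; exact: sqr_ge0.
  move=> /(ler_wpM2l (ltW C0)) H.
  apply: (@le_trans _ _ (C * \int[mu]_(s in I0t t) norm1 (X j.+1 s - X j s) ^+ 2)).
    by rewrite ler_wpM2r// lerDl.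
  apply: le_trans H _.
  rewrite [_ ^+ j.+1]exprSr; move: (4^-1 ^+ j) (expR _) => p E.
  have Cn0 : C != 0 by rewrite gt_eqF.
  by rewrite le_eqVlt; apply/orP; left; apply/eqP; clearbody C; field.
(* [D ^+ 2] absorbs the weight, since [expR (4 * C * t) <= expR (4 * C) ^+ 2] on [0,1]. *)
pose D := M * expR (4 * C).
have D0 : 0 <= D by rewrite mulr_ge0 ?expR_ge0.
have step1 j t : I t -> norm1 (X j.+1 t - X j t) <= D * 2^-1 ^+ j.
  move=> It; rewrite -(@ler_pXn2r _ 2)// ?nnegrE ?norm1_ge0 ?mulr_ge0 ?exprn_ge0//.
  apply: le_trans (step j t It) _.
  rewrite /D !exprMn -exprM mulnC exprM (_ : (2^-1 ^+ 2 : R) = 4^-1); last by field.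
  rewrite -mulrA (mulrC (4^-1 ^+ j)) mulrA ler_wpM2r ?exprn_ge0// ler_wpM2l ?sqr_ge0//.
  move/I01P : It => /andP[t0 t1].
  have e1 : 1 <= expR (4 * C) by rewrite -[leLHS]expR0 ler_expR ltW.
  apply: (@le_trans _ _ (expR (4 * C))).
    by rewrite ler_expR -[leRHS]mulr1 ler_wpM2l// ltW.
  by rewrite expr2 -[leLHS]mulr1 ler_wpM2l// expR_ge0.
have /choice[l lP] : forall ti : R * 'I_n, exists l, I ti.1 -> forall j,
    `|X j ti.1 ti.2 0 - l| <= 2 * D * 2^-1 ^+ j.
  move=> [t i] /=; have [It|nIt] := pselect (I t); last by exists 0.
  have [|l [_ lP]] := @geometric_cvg R (fun j => X j t i 0) D; last by exists l.
  move=> j; apply: le_trans (step1 j t It).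
  by apply: le_trans (entry_le_norm1 _ i); rewrite !mxE.
pose x t : 'cV[R]_n := \col_i l (t, i).
have xX j t : I t -> norm1 (X j t - x t) <= n%:R * (2 * D) * 2^-1 ^+ j.
  move=> It; rewrite -mulrA; apply: norm1_le => i; rewrite !mxE.
  exact: (lP (t, i)).
have mx : meas_path x.
  apply: (meas_path_lim L0 HF (fun j => (good j).1)) => s i Is.
  apply/cvgrPdist_le => e e0.
  have := @cvg_geometric R (2 * D) 2^-1; rewrite ger0_norm// invf_lt1// ltr1n => /(_ isT).
  move=> /cvgrPdist_le /(_ e e0); apply: filterS => j.
  rewrite sub0r normrN ger0_norm; last by rewrite /= !mulr_ge0// exprn_ge0.
  move=> H; rewrite distrC mxE; exact: le_trans (lP (s, i) Is j) H.
have bx : bounded_path x.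
  exists (n%:R * (2 * D)) => s Is; rewrite norm1C.
  by apply: le_trans (xX 0%N s Is) _; rewrite expr0 mulr1.
exists x; apply/is_trajP => t It; split.
  move=> i; apply: ibleS (vfield_ible mx bx cu i) => //; [exact: measurable_I0t|exact: I0tS].
pose Q := n%:R * (2 * D).
have Q0 : 0 <= Q by rewrite !mulr_ge0.
(* The iterate [X j.+1 = picard u (X j)] is inserted; both distances decay geometrically, so [x] is
   a fixed point. [C] replaces the square root of [lip_const u]. *)
have conv j : norm1 (picard u x t - x t) <= 0 + (C * Q + Q) * 2^-1 ^+ j.
  rewrite add0r mulrDl; apply: le_trans (norm1_triangle _ (X j.+1 t) _) _; apply: lerD; last first.
    apply: le_trans (xX j.+1 t It) _; rewrite ler_wpM2l// exprS.
    rewrite -[leRHS]mul1r ler_wpM2r ?exprn_ge0// invf_le1// ler1n.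
    by [].
  have p0 : 0 <= 2^-1 ^+ j :> R by rewrite exprn_ge0.
  rewrite -(@ler_pXn2r _ 2)// ?nnegrE ?norm1_ge0 ?mulr_ge0 ?(ltW C0)//.
  have [mX bX] := good j.
  apply: le_trans (picard_lip mx bx mX bX cu It) _.
  have le1 : \int[mu]_(s in I0t t) (norm1 (x s - X j s) ^+ 2) <= (Q * 2^-1 ^+ j) ^+ 2.
    apply: le_trans (Rintegral_I0t_cst_le (sqr_ge0 _) It).
    apply: le_Rintegral.
    - exact: measurable_I0t.
    - apply: ibleS (norm1B_sqible mx bx mX bX).2 => //; [exact: measurable_I0t|exact: I0tS].
    - by apply: (ible_cst mI finI); [exact: measurable_I0t|exact: I0tS].
    - move=> s /(I0tS It) Is; rewrite norm1C.
      by rewrite lerXn2r ?nnegrE ?norm1_ge0 ?mulr_ge0// xX.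
  rewrite -mulrA [leRHS]exprMn; apply: ler_pM => //.
  - exact: lip_const_ge0.
  - by apply: Rintegral_ge0 => s _; exact: sqr_ge0.
  - by have := lip_const_ge0 u; rewrite /C; nra.
have := le_of_geometric conv => H.
apply/eqP; rewrite eq_sym -subr_eq0 -normr_le0; exact: le_trans (norm_le_norm1 _) H.
Qed.

End Flow.

(** * Compactness of controls *)

(** The image filter has a cluster point in [A]; an ultrafilter decides every set, so clustering
    there means converging. *)
Lemma ultra_compact_cvg (T : Type) (V : topologicalType) (W : set_system T) (f : T -> V)
  (A : set V) : UltraFilter W -> compact A -> W (f @^-1` A) -> exists l : V, f @ W --> l.
Proof.
move=> UW cA WA; have [l [_ cl]] := cA (f @ W) _ WA.
exists l => B /= lB; have [//|WC] := in_ultra_setVsetC (f @^-1` B) UW.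
by have [z [zC zB]] := cl (~` B) B WC lB.
Qed.

Section AscoliSubsequence.
Variables (R : realType) (n : nat).
Local Notation I := (@I01 R).

(* Pointwise limits along an ultrafilter exist by compactness of segments;
   equicontinuity and a finite net make them uniform. *)
Lemma ascoli_subseq (y : nat -> R -> 'cV[R]_n) (M H : R) :
  (forall m t i, I t -> `|y m t i 0| <= M) ->
  (forall m s t, 0 <= s -> s <= t -> t <= 1 -> norm1 (y m t - y m s) ^+ 2 <= H * (t - s)) ->
  exists psi : nat -> nat, {homo psi : p q / (p < q)%N} /\ exists x : R -> 'cV[R]_n,
    forall e, 0 < e -> exists N, forall j, (N <= j)%N -> forall t, I t ->
      norm1 (y (psi j) t - x t) <= e.
Proof.
move=> yM yH.
have [W [UW ooW]] := @ultraFilterLemma _ (\oo : set_system nat) _.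
have /choice[l lP] : forall ti : R * 'I_n, exists l : R, I ti.1 ->
    (fun m => y m ti.1 ti.2 0) @ W --> l.
  move=> [t i] /=; have [It|nIt] := pselect (I t); last by exists 0.
  have [|l lW] := ultra_compact_cvg UW (f := fun m => y m t i 0) (@segment_compact R (- M) M).
    by apply: filterE => m /=; rewrite in_itv/= -ler_norml yM.
  by exists l.
pose x t : 'cV[R]_n := \col_i l (t, i).
have pt t d : I t -> 0 < d -> \forall m \near W, norm1 (y m t - x t) <= d.
  move=> It d0; have dn : 0 < d / (n%:R + 1) by rewrite divr_gt0// ltr_wpDl.
  have : \forall m \near W, forall i, `|y m t i 0 - x t i 0| <= d / (n%:R + 1).
    apply: filter_forall => i; have /cvgrPdist_le /(_ _ dn) := lP (t, i) It.
    by apply: filterS => m; rewrite distrC mxE.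
  apply: filterS => m hm; apply: (@le_trans _ _ (n%:R * (d / (n%:R + 1)))).
    by apply: norm1_le => i; have := hm i; rewrite !mxE.
  rewrite mulrA ler_pdivrMr ?ltr_wpDl// mulrC ler_wpM2l ?(ltW d0)//.
  by rewrite lerDl.
have unif e : 0 < e -> \forall m \near W, forall t, I t -> norm1 (y m t - x t) <= e.
  move=> e0; have e3 : 0 < e / 3 by rewrite divr_gt0.
  have e4 : 0 < (e / 3) ^+ 2 by rewrite exprn_gt0.
  (* A mesh so fine that every [y m] oscillates by at most [e / 3] on each cell. *)
  pose N := (Num.truncn (`|H| / (e / 3) ^+ 2)).+1.
  have NH : `|H| / N%:R <= (e / 3) ^+ 2.
    rewrite ler_pdivrMr ?ltr0Sn// mulrC -ler_pdivrMr//.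
    have /andP[_] := @truncn_itv R (`|H| / (e / 3) ^+ 2) (divr_ge0 (normr_ge0 _) (ltW e4)).
    exact: ltW.
  have N0 : 0 < N%:R :> R by rewrite ltr0Sn.
  have net (t : R) : I t -> exists i : 'I_N.+1, [/\ 0 <= i%:R / N%:R :> R, i%:R / N%:R <= t &
      t - i%:R / N%:R <= N%:R^-1].
    move=> /I01P/andP[t0 t1]; have Nt : 0 <= N%:R * t by rewrite mulr_ge0// ltW.
    have /andP[h1 h2] := truncn_itv Nt.
    have lt : (Num.truncn (N%:R * t) < N.+1)%N.
      rewrite ltnS -(ler_nat R); apply: le_trans h1 _.
      by rewrite -[leRHS]mulr1 ler_wpM2l// ltW.
    exists (Ordinal lt); split => /=.
    - by rewrite divr_ge0.
    - by rewrite ler_pdivrMr// (mulrC t).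
    - rewrite lerBlDr -[X in _ <= X + _]mul1r -mulrDl ler_pdivlMr// (mulrC t).
      by apply: ltW; rewrite addrC natr1.
  have : \forall m \near W, forall i : 'I_N.+1, I (i%:R / N%:R) ->
      norm1 (y m (i%:R / N%:R) - x (i%:R / N%:R)) <= e / 3.
    apply: filter_forall => i; have [Ii|nIi] := pselect (I (i%:R / N%:R)).
      by have := pt _ _ Ii e3; apply: filterS.
    by apply: filterE.
  apply: filterS => m hm t It; have [i [i0 it tN]] := net t It.
  have /andP[t0 t1] := (I01P t).1 It.
  have Ii : I (i%:R / N%:R) by apply/I01P; rewrite i0 (le_trans it t1).
  have osc p : norm1 (y p t - y p (i%:R / N%:R)) <= e / 3.
    rewrite -(@ler_pXn2r _ 2)// ?nnegrE ?norm1_ge0 ?(ltW e3)//.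
    apply: le_trans (yH p _ _ i0 it t1) _; apply: le_trans NH.
    apply: (@le_trans _ _ (`|H| * (t - i%:R / N%:R))).
      by rewrite ler_wpM2r ?subr_ge0// ler_norm.
    by rewrite ler_wpM2l.
  (* The limit inherits the oscillation bound: some index is close to [x] at both points, up to any
     [d]. *)
  have oscx : norm1 (x (i%:R / N%:R) - x t) <= e / 3.
    apply/ler_addgt0Pr => d d0; have d2 : 0 < d / 2 by rewrite divr_gt0.
    have [p [h1 h2]] := filter_ex (filterI (pt _ _ It d2) (pt _ _ Ii d2)).
    have := norm1_triangle (x (i%:R / N%:R)) (y p (i%:R / N%:R)) (x t).
    have := norm1_triangle (y p (i%:R / N%:R)) (y p t) (x t).
    have := osc p; move: h1 h2 => /=.
    rewrite (norm1C (x _) (y p _)) (norm1C (y p (i%:R / N%:R)) (y p t)).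
    lra.
  have := norm1_triangle (y m t) (y m (i%:R / N%:R)) (x t).
  have := norm1_triangle (y m (i%:R / N%:R)) (x (i%:R / N%:R)) (x t).
  have := osc m; have := hm i Ii; lra.
(* [W] contains all tails, so what holds [W]-eventually holds at arbitrarily large indices; this
   turns the ultrafilter limit into a subsequence. *)
have [psi [psiH psiP]] : exists psi : nat -> nat, {homo psi : p q / (p < q)%N} /\
    forall j, forall t, I t -> norm1 (y (psi j) t - x t) <= j.+1%:R^-1.
  apply: (@extraction (fun j p => forall t, I t -> norm1 (y p t - x t) <= j.+1%:R^-1)) => j m.
  have j0 : 0 < j.+1%:R^-1 :> R by rewrite invr_gt0 ltr0Sn.
  by have [p [h1 h2]] := filter_ex (filterI (ooW _ (nbhs_infty_ge m)) (unif _ j0)); exists p.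
exists psi; split => //; exists x => e e0.
have [N _ NP] := near_infty_natSinv_lt (PosNum e0).
exists N => j Nj t It; apply: le_trans (psiP j t It) _.
exact/ltW/(NP j).
Qed.

End AscoliSubsequence.

(** * Passage to the limit in the equation *)

Section Compactness.
Variables (R : realType) (n k : nat) (x0 : 'cV[R]_n) (F : 'cV[R]_n -> 'M[R]_(n, k)) (L : R).
Hypotheses (L0 : 0 <= L) (HF : forall x y, `|F x - F y| <= L * `|x - y|).
Local Notation mu := (@lebesgue_measure R).
Local Notation I := (@I01 R : set (measurableTypeR R)).
Implicit Types (v w : R -> 'cV[R]_k) (x : R -> 'cV[R]_n).
Local Notation meas_path := (meas_path F).
Local Notation bounded_path := (bounded_path x0).
Local Notation is_traj := (is_traj F x0).

Let mI := @measurable_I01 R.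
Let finI := @measure_I01_fin R.
Let I0tS (t : R) (It : I t) : I0t t `<=` I.
Proof. by move/I01P : It => /andP[_]; exact: I0t_sub. Qed.

(** The path [x] is an independent argument, not the trajectory of [v]; this is what makes the
    expression affine in [v]. *)
Definition defect x v t i : R := x0 i 0 + \int[mu]_(s in I0t t) vfield F v x i s - x t i 0.

Lemma ible_vfield_I0t v x t i : meas_path x -> bounded_path x -> L2ctrl v -> I t ->
  ible mu (I0t t) (vfield F v x i).
Proof.
move=> mx bx cv It.
by apply: ibleS (vfield_ible L0 HF mx bx cv i) => //; [exact: measurable_I0t|exact: I0tS].
Qed.

Lemma defect_mid x v w t i : meas_path x -> bounded_path x -> L2ctrl v -> L2ctrl w -> I t ->
  defect x (midpoint v w) t i = 2^-1 * (defect x v t i + defect x w t i).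
Proof.
move=> mx bx cv cw It; rewrite /defect.
have -> : \int[mu]_(s in I0t t) vfield F (midpoint v w) x i s =
    2^-1 * (\int[mu]_(s in I0t t) vfield F v x i s + \int[mu]_(s in I0t t) vfield F w x i s).
  have mt := measurable_I0t t.
  rewrite -RintegralD//; try exact: ible_vfield_I0t.
  rewrite -RintegralZl//; last by apply: ibleD => //; exact: ible_vfield_I0t.
  by apply: eq_Rintegral => s _; rewrite /vfield /midpoint -scalemxAr mulmxDr !mxE.
by field.
Qed.

Lemma defectB x v w t i : meas_path x -> bounded_path x -> L2ctrl v -> L2ctrl w -> I t ->
  defect x v t i - defect x w t i = \int[mu]_(s in I0t t) vfield F (fun s => v s - w s) x i s.
Proof.
move=> mx bx cv cw It; have mt := measurable_I0t t.
have -> : \int[mu]_(s in I0t t) vfield F (fun s => v s - w s) x i s =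
    \int[mu]_(s in I0t t) vfield F v x i s - \int[mu]_(s in I0t t) vfield F w x i s.
  rewrite -RintegralB//; try exact: ible_vfield_I0t.
  by apply: eq_Rintegral => s _; rewrite /vfield mulmxBr !mxE.
by rewrite /defect; ring.
Qed.

Lemma defect_dist x (B : R) v w t i : meas_path x -> bounded_path x -> 0 <= B ->
  (forall s, I s -> `|F x0| + L * norm1 (x s - x0) <= B) ->
  L2ctrl v -> L2ctrl w -> I t ->
  (defect x v t i - defect x w t i) ^+ 2 <= k%:R * L2distsq v w * B ^+ 2.
Proof.
move=> mx bx B0 xB cv cw It; rewrite defectB//.
apply: le_trans (vfield_bound L0 HF i (measurable_I0t t) (I0tS It) (L2ctrlB cv cw) mx
  (sqible_cst mI finI B) xB) _.
by rewrite ler_wpM2l ?mulr_ge0 ?L2sq_ge0//; exact: Rintegral_I0t_cst_le (sqr_ge0 _) It.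
Qed.

Lemma traj_defect0 x w : meas_path x -> bounded_path x -> L2ctrl w ->
  (forall t i, I t -> defect x w t i = 0) -> is_traj w x.
Proof.
move=> mx bx cw d0; apply/is_trajP => t It; split.
  by move=> i; exact: ible_vfield_I0t.
apply/matrixP => i j; rewrite ord1 mxE; apply/esym/eqP; rewrite -subr_eq0; apply/eqP.
exact: d0.
Qed.

(* The defect is affine in the control, so it passes from the tails of [u] to their
   midpoint hulls, and from there to the strong limit [w]. *)
Lemma traj_closed (r : R) (u v : nat -> R -> 'cV[R]_k) (y : nat -> R -> 'cV[R]_n) x w :
  (forall m, L2ctrl (u m)) -> (forall m, L2sq (u m) <= r) -> (forall m, is_traj (u m) (y m)) ->
  (forall e, 0 < e -> exists N, forall j, (N <= j)%N -> forall t, I t ->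
      norm1 (y j t - x t) <= e) ->
  (forall N, midhull u N (v N)) -> L2ctrl w -> (fun N => L2distsq (v N) w) @ \oo --> 0 ->
  is_traj w x.
Proof.
move=> cu ur ty yx hv cw vw.
have mx : meas_path x.
  apply: (meas_path_lim L0 HF (fun m => traj_meas L0 HF (ty m))) => s i Is.
  apply/cvgrPdist_le => e e0; have [N NP] := yx e e0; exists N => // j /= Nj.
  rewrite distrC; apply: le_trans (NP j Nj s Is).
  by apply: le_trans (entry_le_norm1 _ i); rewrite !mxE.
have bx : bounded_path x.
  have [N NP] := yx 1 ltr01; have [M MP] := traj_bounded (ty N).
  exists (1 + M) => s Is; apply: le_trans (norm1_triangle _ (y N s) _) _.
  by rewrite lerD ?MP// norm1C NP.
have [B B0 xB] := bounded_path_F F L0 bx.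
apply: traj_defect0 => // t i It; have mt := measurable_I0t t.
pose Q : R := 1 + k%:R * `|r| * L ^+ 2.
have Q0 : 0 <= k%:R * `|r| * L ^+ 2 by rewrite !mulr_ge0 ?sqr_ge0.
have Q1 : 0 < Q by rewrite ltr_wpDr.
(* Subtracting the equation of [y m] leaves the integral of [(F x - F (y m)) u m], of size [Q * e],
   plus the displacement [y m t - x t], of size [e]. *)
have du m (e : R) : 0 <= e -> (forall s, I s -> norm1 (y m s - x s) <= e) ->
    `|defect x (u m) t i| <= (Q + 1) * e.
  move=> e0 ye.
  have -> : defect x (u m) t i =
      \int[mu]_(s in I0t t) pairing (fun s j => F (x s) i j - F (y m s) i j) (u m) s +
      (y m t i 0 - x t i 0).
    have -> : \int[mu]_(s in I0t t) pairing (fun s j => F (x s) i j - F (y m s) i j) (u m) s =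
        \int[mu]_(s in I0t t) vfield F (u m) x i s - \int[mu]_(s in I0t t) vfield F (u m) (y m) i s.
      rewrite -RintegralB//; [|exact: ible_vfield_I0t|]; last first.
        by have := ((is_trajP x0 F (u m) (y m)).1 (ty m) t It).1 i.
      apply: eq_Rintegral => s _; rewrite !vfieldE /pairing -sumrB.
      by apply: eq_bigr => j _; rewrite mulrBl.
    rewrite (traj_eq (ty m) It) mxE /defect; ring.
  rewrite mulrDl mul1r; apply: le_trans (ler_normD _ _) _; apply: lerD; last first.
    apply: le_trans (ye t It).
    by apply: le_trans (entry_le_norm1 _ i); rewrite !mxE.
  rewrite -(@ler_pXn2r _ 2)// ?nnegrE// ?mulr_ge0 ?(ltW Q1)// real_normK ?num_real//.
  apply: (@le_trans _ _ (k%:R * L2sq (u m) * \int[mu]_(s in I0t t) ((L * e) ^+ 2))).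
    apply: pairing_bound => //; [exact: I0tS|..].
    - by move=> j; apply: measurable_funB; [exact: mx.2|exact: (traj_meas L0 HF (ty m)).2].
    - exact: sqible_cst.
    - move=> s j Is; apply: le_trans (lip_entry L0 HF _ _ _ _) _.
      by rewrite ler_wpM2l// norm1C ye.
  apply: (@le_trans _ _ (k%:R * `|r| * (L * e) ^+ 2)).
    apply: ler_pM.
    - by rewrite mulr_ge0 ?L2sq_ge0.
    - by apply: Rintegral_ge0 => s _; exact: sqr_ge0.
    - by rewrite ler_wpM2l// (le_trans (ur m))// ler_norm.
    - by apply: Rintegral_I0t_cst_le It; exact: sqr_ge0.
  rewrite exprMn mulrA exprMn ler_wpM2r ?sqr_ge0// /Q.
  have := Q0; nra.
have dw (e : R) : 0 < e -> `|defect x w t i| <= (Q + 2) * e.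
  move=> e0; have [N1 N1P] := yx e e0.
  have dh N z : (N1 <= N)%N -> midhull u N z -> `|defect x z t i| <= (Q + 1) * e.
    move=> N1N; elim=> [m Nm|z1 z2 h1 i1 h2 i2].
      by apply: du; [exact: ltW|exact: (N1P m (leq_trans N1N Nm))].
    rewrite (defect_mid i mx bx (midhull_L2ctrl cu h1) (midhull_L2ctrl cu h2) It).
    have := ler_normD (defect x z1 t i) (defect x z2 t i).
    by rewrite normrM ger0_norm//; lra.
  have kB : 0 < k%:R * B ^+ 2 + 1 by rewrite ltr_wpDl// mulr_ge0 ?sqr_ge0.
  have d0 : 0 < e ^+ 2 / (k%:R * B ^+ 2 + 1) by rewrite divr_gt0// exprn_gt0.
  have /cvgrPdist_le /(_ _ d0)[N2 _ N2P] := vw.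
  pose p := maxn N1 N2.
  have := N2P p (leq_maxr _ _); rewrite /= sub0r normrN ger0_norm ?L2sq_ge0// => hN.
  have h1 := dh p _ (leq_maxl _ _) (hv p).
  have cv := midhull_L2ctrl cu (hv p).
  have h2 : `|defect x w t i - defect x (v p) t i| <= e.
    rewrite distrC -(@ler_pXn2r _ 2)// ?nnegrE// ?(ltW e0)// real_normK ?num_real//.
    apply: le_trans (defect_dist i mx bx B0 xB cv cw It) _.
    rewrite mulrAC; move: hN; rewrite ler_pdivlMr// mulrDr mulr1 mulrC.
    by apply: le_trans; rewrite lerDl L2sq_ge0.
  have := ler_normD (defect x w t i - defect x (v p) t i) (defect x (v p) t i).
  rewrite subrK; lra.
apply/eqP; rewrite -normr_le0; apply/ler_addgt0Pr => e e0; rewrite add0r.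
have Q2 : 0 < Q + 2 by lra.
have := dw (e / (Q + 2)); rewrite divr_gt0// => /(_ isT).
by rewrite mulrCA divff ?mulr1// gt_eqF.
Qed.

(** The subsequence is fixed by the trajectories before any hull is formed, so [w] arises from hulls
    of tails of [u \o psi]. The third clause expresses lower semicontinuity through values [c] not
    exceeded infinitely often. *)
Lemma control_compactness (r : R) (u : nat -> R -> 'cV[R]_k) :
  (forall m, L2ctrl (u m)) -> (forall m, L2sq (u m) <= r) ->
  exists psi : nat -> nat, {homo psi : p q / (p < q)%N} /\ exists w : R -> 'cV[R]_k,
  [/\ L2ctrl w, (fun j => endpt F x0 (u (psi j))) @ \oo --> endpt F x0 w,
     forall c, (forall N, exists2 m, (N <= m)%N & L2sq (u (psi m)) <= c) -> L2sq w <= c &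
     (forall m, L2sq (u (psi m)) <= L2sq w) -> (fun m => L2distsq (u (psi m)) w) @ \oo --> 0].
Proof.
move=> cu ur.
have /choice[y ty] := fun m => traj_exists x0 L0 HF (cu m).
have [M MP] := traj_bound x0 L0 HF r; have [H HP] := traj_hoelder x0 L0 HF r.
have [psi [psiH [x yx]]] : exists psi : nat -> nat, {homo psi : p q / (p < q)%N} /\
    exists x : R -> 'cV[R]_n, forall e, 0 < e -> exists N, forall j, (N <= j)%N -> forall t, I t ->
      norm1 (y (psi j) t - x t) <= e.
  apply: (@ascoli_subseq R n y (norm1 x0 + M) H).
    move=> m t i It; have -> : y m t i 0 = x0 i 0 + (y m t - x0) i 0 by rewrite !mxE; ring.
    apply: le_trans (ler_normD _ _) _; apply: lerD; first exact: entry_le_norm1.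
    apply: le_trans (entry_le_norm1 _ i) _.
    by apply: (MP _ _ (cu m) (ur m) (ty m)).
  move=> m s t; exact: (HP _ _ (cu m) (ur m) (ty m)).
exists psi; split => //.
have [v [w [hv cw vw lsc str]]] := midhull_limit (fun m => cu (psi m)) (fun m => ur (psi m)).
have tw : is_traj w x.
  exact: (traj_closed (fun m => cu (psi m)) (fun m => ur (psi m)) (fun m => ty (psi m)) yx hv cw vw).
exists w; split => //; rewrite (endptP L0 HF cw tw).
apply/cvgrPdist_le => e e0; have [N NP] := yx e e0; exists N => // j /= Nj.
rewrite (endptP L0 HF (cu _) (ty (psi j))); apply: le_trans (norm_le_norm1 _) _.
by rewrite norm1C; apply: NP => //; exact: I01_1.
Qed.

End Compactness.

(** * Penalization *)

Section Penalization.
Variables (R : realType) (n k : nat) (x0 : 'cV[R]_n) (F : 'cV[R]_n -> 'M[R]_(n, k)) (L : R).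
Hypotheses (L0 : 0 <= L) (HF : forall x y, `|F x - F y| <= L * `|x - y|).
Variables (a : 'cV[R]_n -> R) (rho : R).
Hypotheses (a_cont : continuous a) (a_ge0 : forall x, 0 <= a x) (rho_gt0 : 0 < rho).
Implicit Types (u v w : R -> 'cV[R]_k).
Local Notation Uball := (@Uball R k rho).
Local Notation Fbeta := (Fbeta F x0 a).
Local Notation Frho := (Frho F x0 a).
Local Notation admissible := [set u | Uball u /\ a (endpt F x0 u) = 0].

Lemma UballP u : Uball u <-> L2ctrl u /\ L2sq u <= rho ^+ 2.
Proof.
split=> -[cu h]; split => //.
  rewrite -(sqr_sqrtr (L2sq_ge0 u)) lerXn2r ?nnegrE ?sqrtr_ge0//; exact: ltW.
by rewrite -(@ler_pXn2r _ 2)// ?nnegrE ?sqrtr_ge0 ?(ltW rho_gt0)// sqr_sqrtr ?L2sq_ge0.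
Qed.

(** [L2sq_perturb] with [e = 2^-1 ^+ j] and [j] tending to infinity. *)
Lemma L2distsq_eq0_L2sq u v : L2ctrl u -> L2ctrl v -> L2distsq u v = 0 -> L2sq u <= L2sq v.
Proof.
move=> cu cv d0; apply: (@le_of_geometric _ _ _ (L2sq v)) => j.
have p0 : 0 < 2^-1 ^+ j :> R by rewrite exprn_gt0.
by have := L2sq_perturb cu cv p0; rewrite d0 mulr0 addr0 mulrDl mul1r mulrC.
Qed.

Lemma L2distsq_eq0_endpt u v : L2ctrl u -> L2ctrl v -> L2distsq u v = 0 ->
  endpt F x0 u = endpt F x0 v.
Proof.
move=> cu cv d0; have [x tx] := traj_exists x0 L0 HF cu.
have mx := traj_meas L0 HF tx; have bx := traj_bounded tx.
have [B B0 xB] := bounded_path_F F L0 bx.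
rewrite (endptP L0 HF cu tx); apply/esym/(endptP L0 HF cv).
apply: (traj_defect0 L0 HF mx bx cv) => t i It.
have du : defect x0 F x u t i = 0 by rewrite /defect (traj_eq tx It) mxE; ring.
have := defect_dist L0 HF i mx bx B0 xB cu cv It.
rewrite d0 du mulr0 mul0r sub0r sqrrN => H.
by apply/eqP; rewrite -sqrf_eq0 eq_le sqr_ge0 andbT.
Qed.

Lemma Uball_compactness (u : nat -> R -> 'cV[R]_k) : (forall m, Uball (u m)) ->
  exists psi : nat -> nat, {homo psi : p q / (p < q)%N} /\ exists w,
  [/\ Uball w, (fun j => a (endpt F x0 (u (psi j)))) @ \oo --> a (endpt F x0 w),
     forall c, (forall N, exists2 m, (N <= m)%N & L2sq (u (psi m)) <= c) -> L2sq w <= c &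
     (forall m, L2sq (u (psi m)) <= L2sq w) -> (fun m => L2distsq (u (psi m)) w) @ \oo --> 0].
Proof.
move=> uU.
have [psi [psiH [w [cw ew lsc str]]]] :=
  control_compactness x0 L0 HF (fun m => ((UballP (u m)).1 (uU m)).1)
    (fun m => ((UballP (u m)).1 (uU m)).2).
exists psi; split => //; exists w; split => //.
  apply/UballP; split => //; apply: lsc => N; exists N => //.
  exact: ((UballP _).1 (uU _)).2.
by apply: continuous_cvg ew; exact: a_cont.
Qed.

Lemma penalty_limit0 (b c : nat -> R) (l C : R) : 0 <= l -> c @ \oo --> l ->
  (forall j, 0 <= c j) -> (forall j, b j * c j <= C) ->
  (forall A, exists N, forall j, (N <= j)%N -> A <= b j) -> l = 0.
Proof.
move=> l0 cl c0 bc by_; apply/eqP; rewrite eq_le l0 andbT.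
apply/ler_addgt0Pr => e e0; rewrite add0r; have e2 : 0 < e / 2 by rewrite divr_gt0.
have /cvgrPdist_le /(_ _ e2)[N1 _ N1P] := cl.
(* Beyond this threshold [b j * (e / 2) >= |C|], and the added 1 makes [b j] positive. *)
have [N2 N2P] := by_ (`|C| / (e / 2) + 1).
pose j := maxn N1 N2.
have := N1P j (leq_maxl _ _) => /=; have {}N2P := N2P j (leq_maxr _ _).
move=> /(le_trans (ler_norm _)) h.
suff : c j <= e / 2 by lra.
have C0 : 0 <= `|C| / (e / 2) by rewrite divr_ge0// ltW.
have b0 : 0 < b j by lra.
rewrite -(ler_pM2l b0); apply: le_trans (bc j) _; apply: le_trans (ler_norm _) _.
by rewrite -ler_pdivrMr//; lra.
Qed.

Lemma Fbeta_minimizer (beta : R) : 0 < beta -> exists u, Uball u /\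
  forall v, Uball v -> Fbeta beta u <= Fbeta beta v.
Proof.
move=> beta0; pose S := [set Fbeta beta u | u in Uball].
have F0 u : 0 <= Fbeta beta u.
  by rewrite addr_ge0// mulr_ge0 ?L2sq_ge0 ?(ltW beta0).
have iS : has_inf S.
  split; last by exists 0 => _ [u _ <-].
  exists (Fbeta beta (fun=> 0)); exists (fun=> 0) => //; apply/UballP.
  by split; [exact: L2ctrl0|rewrite L2sq0 sqr_ge0].
have Sle v : Uball v -> inf S <= Fbeta beta v.
  by move=> vU; apply: ge_inf; [case: iS|exists v].
have /choice[u uP] : forall m : nat, exists u, Uball u /\ Fbeta beta u <= inf S + m.+1%:R^-1.
  move=> m; have m0 : 0 < m.+1%:R^-1 :> R by rewrite invr_gt0 ltr0Sn.
  by have [_ [u uU <-] ult] := inf_adherent m0 iS; exists u; split => //; exact: ltW.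
have [psi [psiH [w [wU aw lsc _]]]] := Uball_compactness (fun m => (uP m).1).
exists w; split => // v vU; apply: le_trans (Sle v vU).
apply/ler_addgt0Pr => e e0.
have e4 : 0 < e / 4 by rewrite divr_gt0.
have e4b : 0 < e / 4 / beta by rewrite divr_gt0.
have /cvgrPdist_le /(_ _ e4b)[N1 _ N1P] := aw.
have [N2 _ N2P] := near_infty_natSinv_lt (PosNum e4).
(* The goal is solved for [L2sq w], the form lower semicontinuity needs; one [e / 4] pays for
   near-minimality, the other for the convergence of the penalty. *)
suff : L2sq w <= 2 * (inf S + e / 2 - beta * a (endpt F x0 w)).
  rewrite /Defs.Fbeta; lra.
apply: lsc => N; exists (maxn N (maxn N1 N2)); first exact: leq_maxl.
set j := maxn _ _.
have h1 := N1P j (leq_trans (leq_maxl _ _) (leq_maxr _ _)).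
have h2 : (psi j).+1%:R^-1 < e / 4.
  apply: (N2P (psi j)); apply: leq_trans (homo_geq_id psiH j).
  exact: (leq_trans (leq_maxr _ _) (leq_maxr _ _)).
have := (uP (psi j)).2; rewrite /Defs.Fbeta.
move: h1 => /= /(le_trans (ler_norm _)); rewrite ler_pdivlMr//.
move: h2; move: (_.+1%:R^-1) => z; lra.
Qed.

Lemma Frho_fin u : a (endpt F x0 u) = 0 -> Frho u = (2^-1 * L2sq u)%:E.
Proof. by rewrite /Defs.Frho => ->; rewrite eqxx. Qed.

Lemma minimizers_compact (b : nat -> R) (u : nat -> R -> 'cV[R]_k) w0 :
  admissible w0 -> (forall m, 0 < b m) ->
  (forall A, exists N, forall j, (N <= j)%N -> A <= b j) ->
  (forall m, Uball (u m) /\ forall v, Uball v -> Fbeta (b m) (u m) <= Fbeta (b m) v) ->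
  exists psi : nat -> nat, {homo psi : p q / (p < q)%N} /\ exists w,
  [/\ admissible w, (fun m => L2distsq (u (psi m)) w) @ \oo --> 0 &
      forall z, admissible z -> L2sq w <= L2sq z].
Proof.
move=> adm0 b0 by_ uP.
(* At an admissible [z] the penalty vanishes, so one comparison bounds the norm and the penalty of
   [u m] for all [m]. *)
have uz m z : admissible z -> 2^-1 * L2sq (u m) + b m * a (endpt F x0 (u m)) <= 2^-1 * L2sq z.
  by move=> [zU az]; have := (uP m).2 z zU; rewrite /Defs.Fbeta az mulr0 addr0.
have uL m z : admissible z -> L2sq (u m) <= L2sq z.
  move=> /(uz m); have : 0 <= b m * a (endpt F x0 (u m)) by rewrite mulr_ge0// ltW.
  lra.
have [psi [psiH [w [wU aw lsc str]]]] := Uball_compactness (fun m => (uP m).1).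
have w0a : admissible w.
  split => //; apply: (@penalty_limit0 (b \o psi) _ _ (2^-1 * L2sq w0) (a_ge0 _) aw) => //.
    move=> j; have := uz (psi j) w0 adm0; have := L2sq_ge0 (u (psi j)); rewrite /=; lra.
  move=> A; have [N NP] := by_ A; exists N => j Nj; apply: NP.
  exact: leq_trans (homo_geq_id psiH j).
exists psi; split => //; exists w; split => //.
  by apply: str => m; exact: uL.
by move=> z az; apply: lsc => N; exists N => //; exact: uL.
Qed.

Lemma inf_Fbeta_le_inf_Frho (beta : R) :
  (ereal_inf [set (Fbeta beta u)%:E | u in Uball] <= ereal_inf [set Frho u | u in Uball])%E.
Proof.
apply: le_ereal_inf_tmp => _ [u uU <-].
rewrite /Defs.Frho; case: eqP => [au|_]; last exact: leey.
by apply: ereal_inf_lbound; exists u => //; rewrite /Defs.Fbeta au mulr0 addr0.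
Qed.

(** Otherwise controls of cost at most [M] exist for arbitrarily large [beta]; a limit of them is
    admissible with half squared norm at most [M]. Testing reals [M] below the infimum treats finite
    and infinite values together. *)
Lemma inf_Fbeta_ge (M : R) : (M%:E < ereal_inf [set Frho u | u in Uball])%E ->
  \forall beta \near +oo, (M%:E <= ereal_inf [set (Fbeta beta u)%:E | u in Uball])%E.
Proof.
move=> Mk.
suff [b0 b0P] : exists b0, forall beta, b0 <= beta ->
    (M%:E <= ereal_inf [set (Fbeta beta u)%:E | u in Uball])%E.
  by apply: filterS (nbhs_pinfty_ge (num_real b0)) => beta; exact: b0P.
apply: contrapT => nex.
have /choice[bu buP] : forall j : nat, exists bu : R * (R -> 'cV[R]_k),
    [/\ j.+1%:R <= bu.1, Uball bu.2 & Fbeta bu.1 bu.2 <= M].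
  move=> j; apply: contrapT => nj; apply: nex; exists j.+1%:R => beta jb.
  apply: le_ereal_inf_tmp => _ [u uU <-]; rewrite lee_fin leNgt; apply/negP => lt.
  by apply: nj; exists (beta, u); split => //; exact: ltW.
have [psi [psiH [w [wU aw lsc _]]]] := Uball_compactness (u := fun j => (bu j).2)
  (fun j => let: And3 _ h _ := buP j in h).
have b0 j : 0 < (bu j).1 by have [h _ _] := buP j; apply: lt_le_trans h; rewrite ltr0Sn.
have w0 : a (endpt F x0 w) = 0.
  apply: (@penalty_limit0 (fun j => (bu (psi j)).1) _ _ M (a_ge0 _) aw) => //.
    move=> j; have [_ _] := buP (psi j); rewrite /Defs.Fbeta.
    have := L2sq_ge0 (bu (psi j)).2; lra.
  move=> A; exists (Num.truncn `|A|) => j Nj; have [h _ _] := buP (psi j).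
  apply: le_trans h; apply: le_trans (ler_norm _) _.
  have /andP[_ /ltW h2] := truncn_itv (normr_ge0 A); apply: le_trans h2 _.
  by rewrite ler_nat ltnS; apply: leq_trans Nj _; exact: homo_geq_id.
move: Mk; rewrite ltNge => /negP; apply.
apply: (@le_trans _ _ (Frho w)); first by apply: ereal_inf_lbound; exists w.
rewrite Frho_fin// lee_fin.
suff : L2sq w <= 2 * M by lra.
apply: lsc => N; exists N => //.
have [_ _] := buP (psi N); rewrite /Defs.Fbeta.
have : 0 <= (bu (psi N)).1 * a (endpt F x0 (bu (psi N)).2) by rewrite mulr_ge0// ltW.
lra.
Qed.

Lemma inf_Frho_ge0 : (0 <= ereal_inf [set Frho u | u in Uball])%E.
Proof.
apply: le_ereal_inf_tmp => _ [u uU <-]; rewrite /Defs.Frho; case: ifP => // _.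
by rewrite lee_fin mulr_ge0// L2sq_ge0.
Qed.

Lemma inf_Fbeta_cvg :
  (fun beta : R => ereal_inf [set (Fbeta beta u)%:E | u in Uball]) @ +oo -->
  ereal_inf [set Frho u | u in Uball].
Proof.
have := inf_Fbeta_ge; have le := inf_Fbeta_le_inf_Frho; have := inf_Frho_ge0.
(* A finite value is squeezed between [le] and [ge], the value +oo needs [ge] alone, and -oo
   contradicts nonnegativity. *)
move: le; case: (ereal_inf [set Frho u | u in Uball]) => [r| |] le //= r0 ge.
  apply/fine_cvgP; split.
    have : (((r - 1)%:E : \bar R) < r%:E)%E by rewrite lte_fin ltrBlDr ltrDl.
    move=> /ge; apply: filterS => beta h.
    rewrite fin_numElt (lt_le_trans _ h) ?ltNyr//= (le_lt_trans (le beta)) ?ltry//.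
  apply/cvgrPdist_le => e e0.
  have : (((r - e)%:E : \bar R) < r%:E)%E by rewrite lte_fin ltrBlDr ltrDl.
  move=> /ge; apply: filterS => beta h; have := le beta; move: h => /=.
  case: (ereal_inf _) => [z| |] //=; rewrite !lee_fin => h1 h2.
  by rewrite ger0_norm ?subr_ge0//; lra.
apply/cvgeyPge => A; apply: ge; exact: ltry.
Qed.

End Penalization.

Theorem mainTheorem20 (R : realType) (n k : nat) (x0 : 'cV[R]_n)
  (F : 'cV[R]_n -> 'M[R]_(n, k)) (a : 'cV[R]_n -> R) (rho : R)
  (HF : exists L : R, forall x y, `|F x - F y| <= L * `|x - y|)
  (Ha_cont : continuous a) (Ha_nonneg : forall x, 0 <= a x)
  (HD : exists x, a x = 0) (Hrho : 0 < rho) :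
  ((fun beta : R => ereal_inf [set (Fbeta F x0 a beta u)%:E | u in @Uball R k rho])
     @ +oo --> ereal_inf [set Frho F x0 a u | u in @Uball R k rho])
  /\
  ((exists u, @Uball R k rho u /\ (Frho F x0 a u < +oo)%E) ->
   (forall beta : R, 0 < beta -> exists u, @Uball R k rho u /\
      forall v, @Uball R k rho v -> Fbeta F x0 a beta u <= Fbeta F x0 a beta v)
   /\
   forall uhat : R -> R -> 'cV[R]_k,
   (forall beta : R, 0 < beta -> @Uball R k rho (uhat beta) /\
      forall v, @Uball R k rho v -> Fbeta F x0 a beta (uhat beta) <= Fbeta F x0 a beta v) ->
   forall b : nat -> R,
   (forall m, 0 < b m) -> {homo b : p q / (p <= q)%N >-> p <= q} -> b @ \oo --> +oo ->
   (* pre-compactness in the strong L^2 topology *)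
   (forall phi : nat -> nat, {homo phi : p q / (p < q)%N} ->
      exists psi : nat -> nat, {homo psi : p q / (p < q)%N} /\
      exists v, L2ctrl v /\
        (fun j => L2distsq (uhat (b (phi (psi j)))) v) @ \oo --> 0)
   /\
   (* every strong limit point is a minimizer of F_rho *)
   (forall v, L2ctrl v ->
      (exists psi : nat -> nat, {homo psi : p q / (p < q)%N} /\
         (fun j => L2distsq (uhat (b (psi j))) v) @ \oo --> 0) ->
      @Uball R k rho v /\
      forall w, @Uball R k rho w -> (Frho F x0 a v <= Frho F x0 a w)%E)).
Proof.
have [L0 HL0] := HF.
(* The given constant carries no sign; its absolute value serves as well. *)
pose L : R := `|L0|; have L_ge0 : 0 <= L by exact: normr_ge0.
have HL x y : `|F x - F y| <= L * `|x - y|.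
  by apply: le_trans (HL0 x y) _; rewrite ler_wpM2r// ler_norm.
split; first exact: (inf_Fbeta_cvg (x0 := x0) L_ge0 HL Ha_cont Ha_nonneg Hrho).
move=> [w0 [w0U w0fin]].
have aw0 : a (endpt F x0 w0) = 0 by move: w0fin; rewrite /Frho; case: eqP.
split=> [beta|]; first exact: (Fbeta_minimizer x0 L_ge0 HL Ha_cont Ha_nonneg Hrho).
move=> uhat uhatP b b0 _ boo.
(* Stated for every subsequence: it gives pre-compactness, and it identifies limit points when
   applied to a convergent subsequence. *)
have compact phi : {homo phi : p q / (p < q)%N} -> exists psi : nat -> nat,
    {homo psi : p q / (p < q)%N} /\ exists w,
    [/\ Uball rho w /\ a (endpt F x0 w) = 0,
        (fun m => L2distsq (uhat (b (phi (psi m)))) w) @ \oo --> 0 &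
        forall z, Uball rho z /\ a (endpt F x0 z) = 0 -> L2sq w <= L2sq z].
  move=> phiH; apply: (minimizers_compact (x0 := x0) L_ge0 HL Ha_cont Ha_nonneg Hrho
    (b := b \o phi) (u := fun m => uhat (b (phi m))) (conj w0U aw0)).
  - by move=> m; exact: b0.
  - move=> A; have /cvgryPge /(_ A)[N _ NP] := boo; exists N => j Nj.
    by apply: NP => /=; apply: leq_trans Nj _; exact: homo_geq_id.
  - by move=> m; exact: uhatP.
split=> [phi /compact[psi [psiH [w [[wU _] wcv _]]]]|v cv [psi [psiH vcv]]].
  by exists psi; split => //; exists w; split => //; case: wU.
(* A further subsequence tends to a minimizer [w]; uniqueness of strong limits puts [v] at distance
   0 from [w], and norm and endpoint carry over. *)
have [chi [chiH [w [[wU aw] wcv wmin]]]] := compact psi psiH.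
have cw : L2ctrl w by case: wU.
have vw0 : L2distsq v w = 0.
  apply/eqP; rewrite eq_le L2sq_ge0 andbT; apply/ler_addgt0Pr => e e0; rewrite add0r.
  have e4 : 0 < e / 4 by rewrite divr_gt0.
  have /cvgrPdist_le /(_ _ e4)[N1 _ N1P] := vcv.
  have /cvgrPdist_le /(_ _ e4)[N2 _ N2P] := wcv.
  pose j := maxn N1 N2.
  have := N1P (chi j) (leq_trans (leq_maxl _ _) (homo_geq_id chiH j)).
  have := N2P j (leq_maxr _ _).
  rewrite /= !sub0r !normrN !ger0_norm ?L2sq_ge0//.
  have cu : L2ctrl (uhat (b (psi (chi j)))) by have [[]] := uhatP _ (b0 (psi (chi j))).
  by have := L2distsq_triangle cv cu cw; rewrite (L2distsqC v (uhat _)); lra.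
have wv0 : L2distsq w v = 0 by rewrite L2distsqC.
have av : a (endpt F x0 v) = 0 by rewrite (L2distsq_eq0_endpt x0 L_ge0 HL cv cw vw0).
split.
  apply/UballP => //; split => //; apply: le_trans (L2distsq_eq0_L2sq cv cw vw0) _.
  by have [] := (UballP Hrho w).1 wU.
move=> z zU; rewrite Frho_fin// /Frho; case: eqP => [az|_]; last exact: leey.
rewrite lee_fin ler_wpM2l//; apply: le_trans (L2distsq_eq0_L2sq cv cw vw0) _.
exact: wmin.
Qed.
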